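(* Let $m$ be a fixed positive integer. For an integer $n \ge 5$ put $$u(n) = \alpha(m) + \min_{\mathcal{N}} \sum_{M \in \mathcal{N}} |A_{n}:M|^{m-1},$$ where the minimum is over all coverings $\mathcal{N}$ of $A_n$. Then, as $n$ goes to infinity through the positive integers that have a prime divisor at most $\sqrt[3]{n}$, $\sigma(A_{n} \wr C_m)$ is asymptotically equal to $u(n)$, i.e. $$\frac{\sigma(A_n \wr C_m)}{u(n)} \to 1.$$
   Context: For a non-cyclic finite group $X$, $\sigma(X)$ denotes the least number of proper subgroups of $X$ whose union is $X$. A covering of $A_n$ is a set of proper subgroups of $A_n$ whose union is $A_n$. $\alpha(m)$ is the number of distinct prime divisors of $m$ (so $\alpha(1)=0$). $A_n$ is the alternating group of degree $n$. $C_m$ is the cyclic group of order $m$, and $S \wr C_m$ is the wreath product $S^m \rtimes C_m$ in which a generator of $C_m$ permutes the $m$ coordinates cyclically. *)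

(* Defs.v *)
From HB Require Import structures.
From mathcomp Require Import all_boot all_fingroup all_solvable.

Set Implicit Arguments.
Unset Strict Implicit.
Unset Printing Implicit Defensive.

Local Open Scope group_scope.

Section Covering.
Variables (gT : finGroupType) (G : {group gT}).
Implicit Types (N : {set {group gT}}) (M : {group gT}).

Definition is_covering N : bool :=
  [forall M : {group gT} in N, M \proper G] &&
  (\bigcup_(M in N) (M : {set gT}) == G).

Definition proper_subgroups : {set {group gT}} :=
  [set M : {group gT} | M \proper G].

Lemma proper_subgroups_covering :
  ~~ cyclic G -> is_covering proper_subgroups.
Proof.
move=> ncG; apply/andP; split; first by apply/forall_inP => M; rewrite inE.
rewrite eqEsubset; apply/andP; split.
  by apply/bigcupsP => M; rewrite inE => /proper_sub.
apply/subsetP => x Gx; apply/bigcupP; exists <[x]>%G; last exact: cycle_id.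
rewrite inE properEneq cycle_subG Gx andbT.
by apply: contra ncG => /eqP <-; exact: cycle_cyclic.
Qed.

(* If G is not cyclic, this is the minimum of F over all coverings of G, by    *)
(* proper_subgroups_covering and arg_minnP. A cyclic group has no covering,    *)
(* and then the value is junk.                                                 *)
Definition min_covering (F : {set {group gT}} -> nat) : nat :=
  F [arg min_(N < proper_subgroups | is_covering N) F N]%N.

Definition sigma : nat := min_covering (fun N => #|N|).

End Covering.

Section CyclicWreath.
Variables (gT : finGroupType) (m : nat).

(* i |-> i + 1 mod m *)
Definition shift_perm : 'S_m := perm (@ordS_inj m).

Lemma order_shift_perm : (0 < m)%N -> #[shift_perm] = m.
Proof.
move=> m_gt0.
have sE k i : (shift_perm ^+ k) i = (i + k) %% m :> nat.
  elim: k => [|k IHk]; first by rewrite expg0 perm1 addn0 modn_small.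
  by rewrite expgSr permM permE /= IHk -addn1 modnDml addn1 addnS.
apply/eqP; rewrite eqn_dvd order_dvdn; apply/andP; split.
  by apply/eqP/permP => i; apply: val_inj; rewrite /= sE perm1 modnDr modn_small.
have := sE #[shift_perm] (Ordinal m_gt0).
by rewrite expg_order perm1 /= add0n => /esym/eqP.
Qed.

Definition wreath_base : finGroupType := {dffun forall _ : 'I_m, gT}.

(* The inverse makes this a right action, the convention of {action aT &-> rT}.*)
Definition wreath_act (f : wreath_base) (s : 'S_m) : wreath_base :=
  [ffun i => f (s^-1 i)].

Lemma wreath_act_is_action : is_action <[shift_perm]> wreath_act.
Proof.
split=> [s f g /ffunP fg | f s t _ _].
  by apply/ffunP => i; have := fg (s i); rewrite !ffunE permK.
by apply/ffunP => i; rewrite !ffunE invMg permM.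
Qed.

Canonical wreath_action := Action wreath_act_is_action.

Lemma wreath_act_is_groupAction :
  is_groupAction [set: wreath_base] wreath_action.
Proof.
move=> s Ds; rewrite inE; apply/andP; split.
  by apply/subsetP => f; rewrite inE.
by apply/morphicP => f g _ _; rewrite !actpermE /=; apply/ffunP => i; rewrite !ffunE.
Qed.

Canonical wreath_groupAction := GroupAction wreath_act_is_groupAction.

Definition wreath : finGroupType := sdprod_by wreath_groupAction.

End CyclicWreath.

Definition alt_wreath (n m : nat) : finGroupType :=
  wreath (subg_of 'Alt_('I_n)%G) m.

Definition alpha (m : nat) : nat := size (primes m).

Definition u (m n : nat) : nat :=
  (alpha m + min_covering 'Alt_('I_n)%G
     (fun N => \sum_(M in N) #|'Alt_('I_n) : M| ^ m.-1))%N.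

(* Main.v *)
From HB Require Import structures.
Require Import Defs.
From mathcomp Require Import all_boot all_order all_fingroup all_solvable.
From mathcomp Require Import zify.

(** Write S for the alternating group of degree n, W for its wreath product with
    C_m, and p for the least prime divisor of n, so that p^3 <= n. The proof finds
    numbers N_i such that the sum L of the N_i^m satisfies L <= sigma(W) <= u and
    u <= (1 + o(1)) L.

    Upper bound (sigma_wreath_le). An element of W whose top component does not
    generate C_m lies in one of alpha(m) subgroups containing the base. If the top
    component of g generates C_m, the first coordinate of g^m lies in a member M
    of a given covering of S, and then g lies in one of |S : M|^(m-1) conjugates
    of the wreath product of M by C_m.

    Lower bound (classes_le_sigma). Put weights on the elements g above a
    generator of C_m, depending only on the first coordinate y of g^m, and show
    that no proper subgroup H of W has too large a weight. Let K be the base part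
    of H and T its first projection. If T <> S, the weight of H is at most
    |T|^(m-1) times that of T. If T = S, simplicity of S forces K, which is not
    the whole base, to have order at most |S|^(m/2), which is negligible. So only
    the proper subgroups T of S matter. The weights live on classes all of whose
    elements fix exactly one of N_i objects permuted transitively by S:

    - for n odd, the n-cycles and the N partitions into p blocks of equal size;
    - for n even, for each odd i < n/2, the permutations with two orbits of sizes
      i and n - i, and the binomial(n, i) subsets of size i.

    The stabilizers of these objects get the largest weight allowed. The other
    subgroups T that meet the classes are transitive and too small to matter.
    If T preserves k > p blocks of size b, then |T| <= (b!)^k k!, which is compared
    with n! / p^n by means of Stirling's bounds (imprimitive_estimate). If T is
    primitive, Bochert's theorem bounds its index below by the factorial of n/2
    (Bochert), which exceeds p^n because p <= n^(1/3).

    Limit (eventually_sandwich). Coverings of S are given by the stabilizers of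
    these objects, completed for n odd by the stabilizers of all subsets, with a
    cost exponentially smaller than that of the partitions, and for n even by the
    stabilizers of the partitions into two halves, whose cost is at most the m-th
    power of one binomial coefficient, while L contains arbitrarily many terms of
    comparable size. *)

Set Implicit Arguments.
Unset Strict Implicit.
Unset Printing Implicit Defensive.
Local Open Scope group_scope.

(** * Minimal coverings and the two kinds of subgroups of a wreath product *)

Section MinCovering.
Variables (gT : finGroupType) (G : {group gT}).
Implicit Types (N : {set {group gT}}) (F : {set {group gT}} -> nat).

(** No proper subgroup contains a generator of a cyclic group. Together with the
    two lemmas below, this makes a minimum over coverings usable as soon as one
    covering has been exhibited. *)
Lemma covering_not_cyclic N : is_covering G N -> ~~ cyclic G.
Proof.
case/andP=> /forall_inP properN /eqP coverN.
apply/cyclicP=> -[x defG].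
have : x \in \bigcup_(M in N) (M : {set gT}) by rewrite coverN defG cycle_id.
case/bigcupP=> M NM Mx; have := properN M NM; rewrite properE defG => /andP[_].
by rewrite cycle_subG Mx.
Qed.

Lemma min_covering_le F N : is_covering G N -> min_covering G F <= F N.
Proof.
move=> covN; have nc := covering_not_cyclic covN.
rewrite /min_covering; case: (arg_minnP F (proper_subgroups_covering nc)) => N0 _.
exact.
Qed.

Lemma min_coveringP F : ~~ cyclic G ->
  exists2 N, is_covering G N & min_covering G F = F N.
Proof.
move=> nc; rewrite /min_covering.
by case: (arg_minnP F (proper_subgroups_covering nc)) => N0; exists N0.
Qed.

End MinCovering.

Section WreathCoordinates.
Variables (gT : finGroupType) (m : nat).
Local Notation W := (wreath gT m).
Local Notation c := (shift_perm m).
Implicit Types (g h : W) (i : 'I_m).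

Definition wtop g : 'S_m := (pair_of_sd g).1.
Definition wbase g : wreath_base gT m := (pair_of_sd g).2.

Lemma wtop_cycle g : wtop g \in <[c]>.
Proof. by case: g => [[s x] p]; case/setXP: (p). Qed.

Lemma wtopM g h : wtop (g * h) = wtop g * wtop h.
Proof. by []. Qed.

Lemma wbaseM g h i : wbase (g * h) i = wbase g ((wtop h)^-1 i) * wbase h i.
Proof. by rewrite /wbase /= mulg_ffun /wreath_act ffunE. Qed.

Lemma wtop1 : wtop 1 = 1. Proof. by []. Qed.

Lemma wbase1 i : wbase 1 i = 1. Proof. by rewrite oneg_ffun. Qed.

Lemma wtopX g n : wtop (g ^+ n) = wtop g ^+ n.
Proof. by elim: n => // n IHn; rewrite !expgSr wtopM IHn. Qed.

Lemma wreath_ext g h : wtop g = wtop h -> wbase g =1 wbase h -> g = h.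
Proof.
case: g h => [[s x] p] [[t y] q] /= est /ffunP exy; apply: val_inj => /=.
by move: est exy; rewrite /wtop /wbase /= => -> ->.
Qed.

Lemma wpair_proof s (x : wreath_base gT m) : s \in <[c]> ->
  (s, x) \in setX <[c]> [set: wreath_base gT m].
Proof. by move=> sc; rewrite !inE sc. Qed.

Definition wpair s x (sc : s \in <[c]>) : W :=
  SdPair (wreath_groupAction gT m) (wpair_proof x sc).

Lemma wtop_morphM : {in [set: W] &, {morph wtop : g h / g * h}}.
Proof. by []. Qed.
Canonical wtop_morphism := Morphism wtop_morphM.

(** Powers of g multiply the coordinates met along the orbit of i under the top
    component; both the covering of W and the weights on W are read off from
    these partial products. *)
Lemma wbaseXS g n i :
  wbase (g ^+ n.+1) (wtop g i) = wbase (g ^+ n) i * wbase g (wtop g i).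
Proof. by rewrite expgSr wbaseM permK. Qed.

End WreathCoordinates.

Lemma shift_permX m k (i : 'I_m) : (shift_perm m ^+ k) i = (i + k) %% m :> nat.
Proof.
elim: k => [|k IHk]; first by rewrite expg0 perm1 addn0 modn_small.
by rewrite expgSr permM permE /= IHk -addn1 modnDml addn1 addnS.
Qed.

Section TopCover.
Variables (gT : finGroupType) (m : nat).
Hypothesis m_gt0 : 0 < m.
Local Notation W := (wreath gT m).
Local Notation c := (shift_perm m).

(** Indexed by the prime divisors of m, these are the maximal subgroups that
    contain the base: they account for the summand alpha m. *)
Definition top_index (r : nat) : {group W} :=
  [group of @wtop gT m @*^-1 <[c ^+ r]>].

Lemma top_index_proper r : r \in primes m -> top_index r \proper [set: W].
Proof.
rewrite mem_primes => /and3P[pr_r _ r_m].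
rewrite properT; apply/eqP=> /setP/(_ (wpair 1 (cycle_id c))).
rewrite !inE /= /wtop /= => c_cr; have : #[c] %| #[c ^+ r] by apply: order_dvdG.
have q_gt0 : 0 < m %/ r by rewrite divn_gt0 ?prime_gt0 // dvdn_leq.
rewrite orderXdiv order_shift_perm // => /(dvdn_leq q_gt0).
by rewrite leqNgt ltn_Pdiv // prime_gt1.
Qed.

Lemma top_cover (g : W) : <[wtop g]> != <[c]> ->
  exists2 r, r \in primes m & g \in top_index r.
Proof.
case/cycleP: (wtop_cycle g) => k tg nc.
have k1 : gcdn k m != 1%N.
  apply: contra nc => /eqP k1; rewrite tg eq_sym -[_ == _]/(generator <[c]> _).
  by rewrite generator_coprime order_shift_perm // coprime_sym /coprime k1.
have d_gt0 : 0 < gcdn k m by rewrite gcdn_gt0 m_gt0 orbT.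
exists (pdiv (gcdn k m)).
  rewrite mem_primes m_gt0 pdiv_prime //=; last by move: k1 d_gt0; case: gcdn => [|[]].
  exact: dvdn_trans (pdiv_dvd _) (dvdn_gcdr _ _).
have /dvdnP[q dk] := dvdn_trans (pdiv_dvd _) (dvdn_gcdl k m).
rewrite !inE /= tg {1}dk.
by rewrite mulnC expgM mem_cycle.
Qed.

End TopCover.

Section ConjugateWreath.
Variables (aT : finGroupType) (G : {group aT}) (m' : nat).
Local Notation m := m'.+1.
Local Notation W := (wreath (subg_of G) m).
Local Notation c := (shift_perm m).
Implicit Types (M : {group aT}) (f : 'I_m -> aT).

(** The conjugate by the base element f of the wreath product of M by C_m; it
    depends only on the right cosets M f(i). *)
Definition conj_wreath M f : {set W} :=
  [set g : W | [forall i, f ((wtop g)^-1 i) * sgval (wbase g i) * (f i)^-1 \in M]].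

Lemma conj_wreath_group_set M f : group_set (conj_wreath M f).
Proof.
apply/group_setP; split=> [|g h].
  by rewrite inE; apply/forallP=> i; rewrite wtop1 wbase1 invg1 perm1 mulg1 mulgV.
rewrite !inE => /forallP Mg /forallP Mh; apply/forallP=> i.
rewrite wtopM wbaseM invMg permM.
have := groupM (Mg ((wtop h)^-1 i)) (Mh i).
by rewrite !mulgA mulgKV.
Qed.

Canonical conj_wreath_group M f := Group (conj_wreath_group_set M f).

Lemma conj_wreath_proper M f : M \proper G -> (forall i, f i \in G) ->
  conj_wreath M f \proper [set: W].
Proof.
move=> /properP[_ [x Gx nMx]] Gf; rewrite properT; apply/eqP=> /setP E.
pose y : wreath_base (subg_of G) m := [ffun i => subg G ((f i)^-1 * x * f i)].
have := E (wpair y (group1 _)); rewrite !inE => /forallP/(_ ord0).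
rewrite /wtop /wbase /= invg1 perm1 ffunE subgK; last by rewrite !groupM ?groupV.
by rewrite !mulgA mulgV mul1g mulgK (negbTE nMx).
Qed.

(** The base element picked by a family of cosets. The coordinate ord0 is
    pinned to 1, which is why only m - 1 cosets are chosen. *)
Definition section_of (phi : {ffun 'I_m' -> {set aT}}) (i : 'I_m) : aT :=
  if unlift ord0 i is Some j then repr (phi j) else 1.

(** Let y_k be the product of the first k coordinates met along the cycle of the
    top component s of g, starting from ord0. The element g sends the coset
    M y_k at s^k(ord0) to the coset M y_(k+1) at s^(k+1)(ord0), and since y_m lies
    in M this closes up after m steps: g stabilizes the section i |-> M y_k with
    i = s^k(ord0), hence lies in the matching conjugate of the wreath product of
    M by C_m. *)
Lemma conj_wreath_cover M (g : W) : M \subset G -> <[wtop g]> = <[c]> ->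
    sgval (wbase (g ^+ m) ord0) \in M ->
  exists2 phi : {ffun 'I_m' -> {set aT}}, phi \in ffun_on (rcosets M G) &
    g \in conj_wreath M (section_of phi).
Proof.
move=> sMG gen My; set s := wtop g.
have os : #[s] = m by rewrite /order gen -[RHS](@order_shift_perm m isT).
have sm : s ^+ m = 1 by apply/eqP; rewrite -order_dvdn os.
have trans_s i : [exists k : 'I_m, (s ^+ k) ord0 == i].
  have /cycleP[k ck] : c ^+ i \in <[s]> by rewrite gen mem_cycle.
  have lt_k : k %% m < m by rewrite ltn_mod.
  apply/existsP; exists (Ordinal lt_k); rewrite /= -[X in _ %% X]os expg_mod_order -ck.
  by apply/eqP/val_inj; rewrite /= shift_permX add0n modn_small.
have /fin_all_exists[e eP] i : exists k : 'I_m, (s ^+ k) ord0 = i.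
  by have /existsP[k /eqP] := trans_s i; exists k.
have e_inj : injective e by move=> i j eij; rewrite -[i]eP eij eP.
have eK k : k < m -> e ((s ^+ k) ord0) = k :> nat.
  move=> lt_k; have [e' _ e'K] := injF_bij e_inj.
  by rewrite -[k]/(nat_of_ord (Ordinal lt_k)) -{1}[Ordinal lt_k]e'K eP e'K.
pose y k : aT := sgval (wbase (g ^+ k) ((s ^+ k) ord0)).
have yS k : y k.+1 = y k * sgval (wbase g ((s ^+ k.+1) ord0)).
  by rewrite /y (expgSr s) permM wbaseXS sgvalM ?inE.
have yD q k : y (q * m + k)%N \in M :* y k.
  rewrite /y expgD (mulnC q) (expgD s) (expgM s) sm expg1n mul1g.
  rewrite wbaseM wtopX permK sgvalM ?inE // mem_rcoset mulgK.
  elim: q => [|q IHq]; first by rewrite muln0 wbase1 group1.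
  rewrite mulnS addnC expgD wbaseM wtopX -/s sm invg1 perm1.
  by rewrite sgvalM ?inE // groupM.
have Gy k : y k \in G by apply: subgP.
pose phi : {ffun 'I_m' -> {set aT}} := [ffun i => M :* y (e (lift ord0 i))].
have fP k : section_of phi ((s ^+ k) ord0) \in M :* y k.
  rewrite (divn_eq k m); set r := k %% m; set q := k %/ m.
  have -> : s ^+ (q * m + r) = s ^+ r.
    by rewrite expgD mulnC expgM sm expg1n mul1g.
  rewrite (rcoset_eqP (yD q r)).
  have er : e ((s ^+ r) ord0) = r :> nat by rewrite eK ?ltn_mod.
  rewrite /section_of; case: unliftP => [j def_j|def_0].
    by rewrite ffunE -def_j er mem_repr_rcoset.
  have -> : r = 0%N by rewrite -er def_0 -[ord0](perm1 ord0) -(expg0 s) eK.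
  by rewrite /y expg0 wbase1 mulg1 group1.
exists phi.
  by apply/ffun_onP=> i; rewrite ffunE mem_rcosets mulSGid // Gy.
rewrite inE; apply/forallP=> i; rewrite -/s.
have [k def_i] : exists k, i = (s ^+ k.+1) ord0.
  by exists (e (s^-1 i)); rewrite expgSr permM eP permKV.
have -> : s^-1 i = (s ^+ k) ord0 by rewrite def_i expgSr permM permK.
rewrite def_i; have /rcosetP[a Ma ->] := fP k; have /rcosetP[b Mb ->] := fP k.+1.
by rewrite yS !invMg !mulgA mulgK mulgK groupM ?groupV.
Qed.

End ConjugateWreath.

Lemma card_bigcup_le (I T : finType) (A : pred I) (F : I -> {set T}) :
  (#|\bigcup_(i in A) F i| <= \sum_(i in A) #|F i|)%N.
Proof.
elim/big_rec2: _ => [|i n B _ leB]; first by rewrite cards0.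
by rewrite (leq_trans (leq_card_setU _ _)) // leq_add2l.
Qed.

(** Elements with a non generating top component are covered by the subgroups
    top_index r; any other g is covered through the member of N that contains the
    first coordinate of g^m. A member M of N contributes one subgroup for each
    choice of m - 1 cosets of M. *)
Lemma sigma_wreath_le (aT : finGroupType) (G : {group aT}) m (N : {set {group aT}}) :
    0 < m -> is_covering G N ->
  (~~ cyclic [set: wreath (subg_of G) m]) /\
  (sigma [set: wreath (subg_of G) m]%G <= alpha m + \sum_(M in N) #|G : M| ^ m.-1)%N.
Proof.
case: m => // m' _ covN; have /andP[/forall_inP properN /eqP coverN] := covN.
set m := m'.+1; set W := wreath _ _.
pose tops := [set H in map (@top_index (subg_of G) m) (primes m)].
pose phis (M : {group aT}) := [set phi in ffun_on (rcosets M G) : pred {ffun 'I_m' -> {set aT}}].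
pose conjs (M : {group aT}) := [set conj_wreath_group G M (section_of phi) | phi in phis M].
pose N' := tops :|: \bigcup_(M in N) conjs M.
have covN' : is_covering [set: W]%G N'.
  apply/andP; split.
    apply/forall_inP=> H /setUP[|/bigcupP[M NM /imsetP[phi]]].
      by rewrite inE => /mapP[r m_r ->]; apply: top_index_proper.
    rewrite inE => /ffun_onP Gphi ->; apply: conj_wreath_proper; first exact: properN.
    move=> i; rewrite /section_of; case: unlift => // j.
    have /rcosetsP[x Gx ->] := Gphi j; apply: subsetP (mem_repr_rcoset _ _).
    by rewrite mul_subG ?sub1set ?proper_sub ?properN.
  rewrite eqEsubset subsetT; apply/subsetP=> g _.
  have [gen|/top_cover[//|r m_r rg]] := eqVneq <[wtop g]> <[shift_perm m]>; last first.
    apply/bigcupP; exists (top_index (subg_of G) m r) => //.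
    by apply/setUP; left; rewrite inE map_f.
  have : sgval (wbase (g ^+ m) ord0) \in \bigcup_(M in N) (M : {set aT}).
    by rewrite coverN subgP.
  case/bigcupP=> M NM My; have sMG := proper_sub (properN M NM).
  have [phi phiP gphi] := conj_wreath_cover sMG gen My.
  apply/bigcupP; exists (conj_wreath_group G M (section_of phi)) => //.
  apply/setUP; right; apply/bigcupP; exists M => //; apply: imset_f.
  by rewrite inE.
split; first exact: covering_not_cyclic covN'.
apply: leq_trans (min_covering_le _ covN') _.
rewrite (leq_trans (leq_card_setU _ _)) // leq_add //.
  by rewrite cardsE (leq_trans (card_size _)) // size_map.
rewrite (leq_trans (card_bigcup_le _ _)) //; apply: leq_sum => M _.
rewrite (leq_trans (leq_imset_card _ _)) // cardsE card_ffun_on card_ord.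
by [].
Qed.

(** * Subdirect subgroups of a power of a simple group *)

Section SubdirectOrder.
Variables (gT : finGroupType) (m : nat) (K : {group wreath_base gT m}).
Local Notation pr i := (dffun_morphism (fun _ : 'I_m => gT) i).
Local Notation N i := (K :&: 'ker (pr i)).

Lemma mem_prker i (k : wreath_base gT m) : (k \in N i) = (k \in K) && (k i == 1).
Proof.
rewrite inE; congr (_ && _); apply/idP/eqP => [/(kerP (pr i) (in_setT k))//|ki].
exact/(kerP (pr i) (in_setT k)).
Qed.

(** If every kernel of a coordinate projection occurs at least twice, there are
    at most m/2 distinct kernels, and an element of K is determined by one
    coordinate for each of them. *)
Lemma subdirect_card : (forall i, exists2 j, j != i & N j = N i) ->
  #|K| <= #|gT| ^ m./2.
Proof.
move=> pairN; pose Q := [set N i | i : 'I_m].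
have QN i : N i \in Q by apply/imsetP; exists i.
have cQ : #|Q| <= m./2.
  rewrite geq_half_double -muln2 -[X in _ <= X]card_ord -cardsT.
  pose F (B : {set wreath_base gT m}) := [set i | N i == B].
  have injF : {in Q &, injective F}.
    move=> B C /imsetP[i _ ->] _ /setP/(_ i); rewrite !inE eqxx.
    by move/esym/eqP.
  have parF : partition (F @: Q) setT.
    apply/and3P; split.
    - apply/eqP/setP=> i; rewrite !inE; apply/bigcupP; exists (F (N i)).
        by apply: imset_f.
      by rewrite inE.
    - apply/trivIsetP=> _ _ /imsetP[B _ ->] /imsetP[C _ ->] neBC.
      rewrite -setI_eq0; apply/eqP/setP=> i; rewrite !inE.
      by apply: contraNF neBC => /andP[/eqP<- /eqP<-].
    - apply/negP=> /imsetP[B /imsetP[i _ ->]] /setP/(_ i).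
      by rewrite !inE eqxx.
  rewrite -sum_nat_const (card_partition parF) (big_imset _ injF) /=.
  apply: leq_sum => B /imsetP[i _ ->]; have [j ji Nji] := pairN i.
  have : [set i; j] \subset F (N i).
    by rewrite subUset !sub1set !inE eqxx Nji eqxx.
  by move/subset_leq_card; rewrite cards2 eq_sym ji.
pose f (k : wreath_base gT m) : {ffun seq_sub (enum Q) -> gT} :=
  [ffun q => odflt 1 (omap k [pick i | N i == ssval q])].
have injf : {in K &, injective f}.
  move=> k l Kk Kl /ffunP fkl; apply/ffunP=> i.
  have Nq : N i \in enum Q by rewrite mem_enum.
  have := fkl (SeqSub Nq); rewrite !ffunE /=.
  case: pickP => [j /eqP Nj /= kl|/(_ i)]; last by rewrite eqxx.
  have : k * l^-1 \in N j by rewrite mem_prker groupM ?groupV //= mulg_ffun invg_ffun kl mulgV.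
  by rewrite Nj mem_prker mulg_ffun invg_ffun -eq_mulgV1 => /andP[_ /eqP].
rewrite -(card_in_imset injf) (leq_trans (max_card _)) // card_ffun.
rewrite leq_pexp2l //; first by apply/card_gt0P; exists 1.
by rewrite card_seq_sub ?enum_uniq // -cardE.
Qed.

End SubdirectOrder.

Section Subdirect.
Variables (gT : finGroupType) (m : nat).
Hypotheses (simS : simple [set: gT]) (nabS : ~~ abelian [set: gT]).
Variable K : {group wreath_base gT m}.
Local Notation pr i := (dffun_morphism (fun _ : 'I_m => gT) i).
Hypothesis prK : forall i, pr i @* K = [set: gT].
Local Notation N i := (K :&: 'ker (pr i)).

(** Distinct kernels N i and N j satisfy p_i(N j) = S, because p_i(N j) is normal
    in the simple group S. As [S, S] = S, this survives intersections: the
    projection p_i of N j1 :&: ... :&: N jr is still all of S when i is none of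
    the j's. For r = m - 1 this says that K contains the i-th factor. *)
Lemma subdirect_full : {in predT &, injective (fun i => N i)} -> K = [set: wreath_base gT m] :> {set _}.
Proof.
move=> injN.
pose cap (j : 'I_m) (B : {group wreath_base gT m}) := [group of B :&: 'ker (pr j)].
pose A (s : seq 'I_m) := foldr cap K s.
have derS : [~: [set: gT], [set: gT]] = [set: gT].
  have /simpleP[_ nS] := simS.
  case: (nS [~: [set: gT], [set: gT]]%G) => //=; first exact: (der_normal 1 [set: gT]).
  by move/commG1P; rewrite -[_ \subset _]/(abelian _) (negbTE nabS).
have simp i (B : {group wreath_base gT m}) : K \subset 'N(B) ->
    pr i @* B = 1 \/ pr i @* B = [set: gT].
  move=> nBK; have /simpleP[_ nS] := simS; apply: (nS (pr i @* B)%G).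
  by rewrite /normal subsetT; have := morphim_norms (pr i) nBK; rewrite prK.
have nK j : K \subset 'N('ker (pr j)) by rewrite (subset_trans (subsetT K)) // ker_norm.
have nA s : K \subset 'N(A s).
  by elim: s => [|j s IHs]; rewrite ?normG //= normsI.
have sA s : A s \subset K.
  by elim: s => //= j s IHs; rewrite (subset_trans (subsetIl _ _)).
have cN l : (#|N l| * #|[set: gT]| = #|K|)%N.
  by rewrite -(prK l) card_morphim setTI LagrangeI.
have prN i j : i != j -> pr i @* N j = [set: gT].
  move=> ij; have [|prN1|//] := simp i [group of N j]; first by rewrite normsI ?normG.
  case/eqP: ij; apply: injN => //; apply/esym/eqP.
  have sN : N j \subset N i.
    by rewrite subsetI subsetIl -sub_morphim_pre ?subsetT //; apply/trivgP.
  by rewrite eqEcard sN -(leq_pmul2r (cardG_gt0 [set: gT])) !cN leqnn.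
have full i s : i \notin s -> pr i @* A s = [set: gT].
  elim: s => [|j s IHs] //=.
  rewrite inE negb_or => /andP[ij /IHs fullA]; apply/eqP.
  rewrite eqEsubset subsetT -derS -[X in [~: X, _]]fullA -(prN i j ij).
  have nNK : K \subset 'N(N j) by rewrite normsI ?normG.
  rewrite -morphimR ?subsetT // morphimS //= subsetI.
  rewrite commg_subl (subset_trans (subsetIl _ _)) ?nA //=.
  apply: subset_trans (subsetIr K _).
  by rewrite commg_subr (subset_trans (sA s)).
have K1 (i : 'I_m) (x : gT) : @dfung1 'I_m (fun _ => gT) i x \in K.
  have : x \in pr i @* A (enum (predC1 i)) by rewrite full ?inE // mem_enum !inE eqxx.
  case/morphimP=> k _ Ak /= ->.
  suffices <- : k = @dfung1 'I_m (fun _ => gT) i (k i) by apply: subsetP (sA _) _ Ak.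
  apply/ffunP=> j; have [<-|ij] := eqVneq i j; first by rewrite dfung1_id.
  rewrite dfung1_dflt //; have : j \in enum (predC1 i) by rewrite mem_enum !inE eq_sym.
  elim: (enum _) Ak => //= l s IHs /setIP[As kl]; rewrite inE => /predU1P[->|]; last exact: IHs.
  by have:= kerP (pr l) (in_setT k) kl.
apply/eqP; rewrite eqEsubset subsetT; apply/subsetP=> k _.
have -> : k = \prod_i @dfung1 'I_m (fun _ => gT) i (k i).
  apply/ffunP=> i; rewrite prodg_ffun (big_only1 i) ?dfung1_id //.
  by move=> j ij _; rewrite dfung1_dflt.
by rewrite group_prod // => i _; apply: K1.
Qed.
End Subdirect.

(** * Weights on the elements above a generator of the cyclic group *)

Section WeightBound.
Variables (gT : finGroupType) (m' : nat).
Local Notation m := m'.+1.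
Local Notation W := (wreath gT m).
Local Notation c := (shift_perm m).
Local Notation base := (wreath_base gT m).
Implicit Types (g h : W) (k l : base) (i : 'I_m).

Definition emb k : W := wpair k (group1 <[c]>).

(** The coordinates of g^m are conjugate in S when the top component of g is c,
    so any of them would do. *)
Definition cyc_prod g : gT := wbase (g ^+ m) ord0.

Lemma embM k l : emb (k * l) = emb k * emb l.
Proof.
apply: wreath_ext; first by rewrite wtopM mulg1.
by move=> i; rewrite wbaseM /wbase /wtop /= mulg_ffun invg1 perm1.
Qed.

Lemma top1_emb g : wtop g = 1 -> g = emb (wbase g).
Proof. by move=> g1; apply: wreath_ext. Qed.

Lemma shift_cycle0 i : (c ^+ i) ord0 = i.
Proof. by apply: val_inj; rewrite /= shift_permX add0n modn_small. Qed.

(** The product runs along the m-cycle and its first factor is the coordinate at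
    c ord0, which is thus determined by the product and the other coordinates. *)
Lemma cyc_prod_inj g g' : wtop g = c -> wtop g' = c ->
    (forall i, i != ord0 -> wbase g (c i) = wbase g' (c i)) ->
  cyc_prod g = cyc_prod g' -> wbase g (c ord0) = wbase g' (c ord0).
Proof.
move=> tg tg' egg'; pose x := wbase g (c ord0); pose x' := wbase g' (c ord0).
have E j : j < m -> x^-1 * wbase (g ^+ j.+1) ((c ^+ j.+1) ord0) =
                    x'^-1 * wbase (g' ^+ j.+1) ((c ^+ j.+1) ord0).
  elim: j => [|j IHj] lt_j; first by rewrite !expg1 /x /x' !mulVg.
  have S h : wtop h = c -> wbase (h ^+ j.+2) ((c ^+ j.+2) ord0) =
      wbase (h ^+ j.+1) ((c ^+ j.+1) ord0) * wbase h (c ((c ^+ j.+1) ord0)).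
    by move=> th; rewrite (expgSr c) permM -th wbaseXS.
  rewrite !S // !mulgA (IHj (ltnW lt_j)) egg' //.
  by rewrite -val_eqE /= shift_permX add0n modn_small.
have cm : (c ^+ m) ord0 = ord0.
  by apply: val_inj; rewrite /= shift_permX add0n modnn.
have := E m' (ltnSn m'); rewrite cm -/(cyc_prod g) -/(cyc_prod g') => E1 ey.
by apply: invg_inj; move: E1; rewrite ey => /mulIg.
Qed.

Section FixSubgroup.
Variable h0 : W.
Hypothesis top_h0 : wtop h0 = c.

(** A change of variables on the coset of the base through h0: it trades the
    coordinate ord0 of k for the product along the cycle, which is what a weight
    sees. *)
Definition psi k : base := [ffun i => if i == ord0 then cyc_prod (emb k * h0) else k i].

Lemma wtop_coset k : wtop (emb k * h0) = c.
Proof. by rewrite wtopM mul1g. Qed.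

Lemma wbase_coset k i : wbase (emb k * h0) (c i) = k i * wbase h0 (c i).
Proof. by rewrite wbaseM top_h0 permK. Qed.

Lemma psi_inj : injective psi.
Proof.
move=> k l /ffunP ekl.
have ek i : i != ord0 -> k i = l i.
  by move=> i0; have := ekl i; rewrite !ffunE (negbTE i0).
have e0 : cyc_prod (emb k * h0) = cyc_prod (emb l * h0).
  by have := ekl ord0; rewrite !ffunE eqxx.
apply/ffunP=> i; have [->|/ek //] := eqVneq i ord0.
have := cyc_prod_inj (wtop_coset k) (wtop_coset l) _ e0.
rewrite !wbase_coset => E; apply: (mulIg (wbase h0 (c ord0))); apply: E => j j0.
by rewrite !wbase_coset ek.
Qed.

Lemma sum_coset (H : {group W}) (F : W -> nat) : h0 \in H ->
  \sum_(g in H | wtop g == c) F g = \sum_(k | emb k \in H) F (emb k * h0)%g.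
Proof.
move=> Hh0; rewrite (reindex_onto (fun k => emb k * h0) (fun g => wbase (g * h0^-1))) /=.
  apply: eq_bigl => k; rewrite groupMr // wtop_coset eqxx mulgK eqxx andbT.
  by rewrite andbT.
move=> g /andP[Hg /eqP tg].
rewrite -top1_emb ?mulgKV // wtopM tg.
have : wtop (h0 * h0^-1) = 1 by rewrite mulgV.
by rewrite wtopM top_h0.
Qed.

End FixSubgroup.

Section BaseSubgroup.
Variable H : {group W}.

Definition base_part : {set base} := [set k | emb k \in H].

Lemma base_part_group_set : group_set base_part.
Proof.
apply/group_setP; split=> [|k l]; last by rewrite !inE embM; apply: groupM.
by rewrite inE -[emb 1](mulg1) -(mulgV (emb 1)) mulgA -embM mulg1 mulgV group1.
Qed.
Canonical base_part_group := Group base_part_group_set.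

Local Notation K := base_part_group.
Local Notation pr i := (dffun_morphism (fun _ : 'I_m => gT) i).
Local Notation N i := (K :&: 'ker (pr i)).

(** Conjugation by h permutes the coordinates of K by the top component of h and
    conjugates each of them, so the projections of K on an orbit of coordinates
    look alike. *)
Lemma base_part_conj h k : h \in H -> k \in K ->
  exists2 l, l \in K & forall i, l (wtop h i) = k i ^ wbase h (wtop h i).
Proof.
move=> Hh; rewrite inE => Hk; pose e := emb k ^ h.
have te : wtop e = 1.
  by apply: (mulgI (wtop h)); rewrite -wtopM -conjgC wtopM mul1g mulg1.
exists (wbase e); first by rewrite inE -top1_emb // groupJ.
move=> i; have : wbase (h * e) (wtop h i) = wbase (emb k * h) (wtop h i).
  by rewrite -conjgC.
rewrite !wbaseM te invg1 perm1 permK => E.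
by apply: (mulgI (wbase h (wtop h i))); rewrite E -conjgC.
Qed.

Variable h0 : W.
Hypotheses (Hh0 : h0 \in H) (top_h0 : wtop h0 = c).

Lemma card_proj i : #|pr i @* K| = #|pr ord0 @* K|.
Proof.
have leS h j : h \in H -> #|pr j @* K| <= #|pr (wtop h j) @* K|.
  move=> Hh; rewrite -(cardJg (pr j @* K) (wbase h (wtop h j))) subset_leq_card //.
  apply/subsetP=> _ /imsetP[_ /morphimP[k _ Kk ->] ->] /=.
  have [l Kl <-] := base_part_conj Hh Kk.
  by apply/morphimP; exists l => //; rewrite inE.
have H0 j : h0 ^+ j \in H by rewrite groupX.
apply/eqP; rewrite eqn_leq.
have := leS _ i (groupVr (H0 i)); have := leS _ ord0 (H0 i).
have tV : wtop (h0 ^+ i)^-1 = (c ^+ i)^-1.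
  apply: (mulgI (wtop (h0 ^+ i))); rewrite -wtopM mulgV.
  by rewrite wtopX top_h0 mulgV.
have cV : (c ^+ i)^-1 i = ord0 by rewrite -{2}(shift_cycle0 i) permK.
by rewrite tV wtopX top_h0 shift_cycle0 cV => -> ->.
Qed.

(** Via psi, the coset of K through h0 injects into the product of the
    projections of K, and the weight only depends on the coordinate ord0; there
    psi k lies in the first projection because the m-th power of an element of H
    lying above c belongs to the base part of H. *)
Lemma weight_proj (w : gT -> nat) :
  \sum_(k in K) w (cyc_prod (emb k * h0)%g)
    <= #|pr ord0 @* K| ^ m' * \sum_(y in pr ord0 @* K) w y.
Proof.
pose T i := pr i @* K.
have psiT k : k \in K -> psi h0 k \in family T.
  move=> Kk; have Hk : emb k \in H by have := Kk; rewrite inE.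
  apply/familyP=> i; rewrite ffunE; case: eqVneq => [->|_].
    have t1 : wtop ((emb k * h0) ^+ m) = 1.
      rewrite wtopX wtop_coset //; apply/permP=> j; apply: val_inj.
      by rewrite /= shift_permX perm1 modnDr modn_small.
    apply/morphimP; exists (wbase ((emb k * h0) ^+ m)); rewrite ?inE //.
    by rewrite -top1_emb // groupX // groupM.
  by apply/morphimP; exists k; rewrite ?inE.
pose F i (y : gT) := if i == ord0 then w y else 1%N.
have -> : \sum_(k in K) w (cyc_prod (emb k * h0)%g) =
          \sum_(f in psi h0 @: K) w (f ord0).
  rewrite big_imset /=; first by apply: eq_bigr => k _; rewrite ffunE eqxx.
  by move=> k l _ _; apply: psi_inj.
apply: (@leq_trans (\sum_(f in family T) \prod_i F i (f i))).
  rewrite [X in _ <= X]big_mkcond [X in X <= _]big_mkcond /=.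
  apply: leq_sum => f _; case: ifP => // /imsetP[k Kk ->].
  rewrite psiT // (bigD1 ord0) //= {1}/F eqxx big1 ?muln1 // => i.
  by rewrite /F => /negbTE->.
rewrite -bigA_distr_big_dep /= (bigD1 ord0) //= mulnC leq_mul //.
rewrite (eq_bigr (fun _ => #|T ord0|)) => [|i i0].
  by rewrite prod_nat_const cardC1 card_ord.
by rewrite -(card_proj i) -sum1_card; apply: eq_bigr => y _; rewrite /F (negbTE i0).
Qed.

Hypotheses (simS : simple [set: gT]) (nabS : ~~ abelian [set: gT]).

Lemma base_part_full : K = [set: base] :> {set base} -> H = [set: W] :> {set W}.
Proof.
move=> fullK; apply/eqP; rewrite eqEsubset subsetT; apply/subsetP=> g _.
have /cycleP[j tg] := wtop_cycle g.
have t1 : wtop (g * h0 ^- j) = 1.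
  have : wtop (h0 ^+ j * h0 ^- j) = 1 by rewrite mulgV.
  by rewrite !wtopM wtopX top_h0 -tg.
rewrite -[g](mulgKV (h0 ^+ j)) groupM ?groupX // (top1_emb t1).
have : wbase (g * h0 ^- j) \in (K : {set base}) by rewrite fullK inE.
by rewrite inE.
Qed.

(** If K were to have pairwise distinct kernels it would be the whole base, and H
    the whole group. So two kernels agree, and since H permutes the coordinates
    transitively each kernel agrees with another one. *)
Lemma card_base_part : H \proper [set: W] -> pr ord0 @* K = [set: gT] ->
  (0 < m')%N /\ #|K| <= #|gT| ^ m./2.
Proof.
move=> prH prK0.
have prK i : pr i @* K = [set: gT].
  by apply/eqP; rewrite eqEcard subsetT -prK0 card_proj leqnn.
have nfull : K != [set: base] :> {set base}.
  apply: contraTneq prH => /base_part_full->.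
  by rewrite properxx.
have [noninj|inj] := boolP [exists i, exists j, (i != j) && (N i == N j)]; last first.
  case/eqP: nfull; apply: subdirect_full => // i j _ _ eN; apply: contraNeq inj => ij.
  by apply/existsP; exists i; apply/existsP; exists j; rewrite ij; apply/eqP.
have [i /existsP[j /andP[ij /eqP eN]]] := existsP noninj.
split.
  by move: ij (ltn_ord i) (ltn_ord j); rewrite -val_eqE /=; lia.
apply: subdirect_card => l.
have shiftN h a b : h \in H -> N a = N b -> N (wtop h a) \subset N (wtop h b).
  move=> Hh eab; apply/subsetP=> k; rewrite !mem_prker => /andP[Kk /eqP ka].
  rewrite Kk; have [k' Kk' ek'] := base_part_conj (groupVr Hh) Kk.
  have tV x : wtop h^-1 (wtop h x) = x.
    by rewrite -permM -wtopM mulgV perm1.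
  have : k' \in N a.
    by rewrite mem_prker Kk'; have := ek' (wtop h a); rewrite tV ka conj1g => ->/=.
  rewrite eab mem_prker Kk'; have := ek' (wtop h b); rewrite tV => -> /=.
  by rewrite conjg_eq1.
have [h Hh hl] : exists2 h, h \in H & wtop h i = l.
  exists ((h0 ^+ i)^-1 * h0 ^+ l); first by rewrite groupM ?groupV ?groupX.
  rewrite wtopM wtopX top_h0 permM.
  have tV : wtop (h0 ^+ i)^-1 = (c ^+ i)^-1.
    apply: (mulgI (wtop (h0 ^+ i))); rewrite -wtopM mulgV.
    by rewrite wtopX top_h0 mulgV.
  by rewrite tV -{2}(shift_cycle0 i) permK shift_cycle0.
exists (wtop h j); first by rewrite -hl (inj_eq perm_inj) eq_sym.
by rewrite -hl; apply/eqP; rewrite eqEsubset !shiftN.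
Qed.

End BaseSubgroup.

End WeightBound.

(** A covering of the wreath product covers the elements above the generator c,
    whose total weight is the left-hand side. A proper subgroup H captures weight
    at most B: if it meets that coset, either its first projection T is proper,
    and weight_proj applies, or its base part is a proper subdirect subgroup,
    hence of order at most the power m/2 of the order of S. *)
Lemma weight_le_sigma_type (gT : finGroupType) m (w : gT -> nat) B :
    0 < m -> simple [set: gT] -> ~~ abelian [set: gT] ->
    (~~ cyclic [set: wreath gT m]) ->
    (forall T : {group gT}, T \proper [set: gT] ->
      #|T| ^ m.-1 * \sum_(y in T) w y <= B)%N ->
    (1 < m -> forall y, w y * #|gT| ^ m./2 <= B)%N ->
  (#|gT| ^ m.-1 * \sum_y w y <= B * sigma [set: wreath gT m]%G)%N.
Proof.
case: m => // m' _ simS nabS ncW wT wdiag; set m := m'.+1; set c := shift_perm m.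
have [N /andP[/forall_inP properN /eqP coverN]] :=
  min_coveringP (fun N => #|N|) ncW.
rewrite -/(sigma _) => ->.
pose F (g : wreath gT m) := w (cyc_prod g).
have -> : (#|gT| ^ m' * \sum_y w y = \sum_(g | wtop g == c) F g)%N.
  have tc : wtop (wpair (1 : wreath_base gT m) (cycle_id c)) = c by [].
  set h0 := wpair _ _ in tc.
  transitivity (\sum_(g in [set: wreath gT m] | wtop g == c) F g)%N; last first.
    by apply: eq_bigl => g; rewrite inE.
  rewrite (sum_coset tc); last by rewrite inE.
  transitivity (\sum_(k : wreath_base gT m) w (psi h0 k ord0))%N; last first.
    by apply: eq_big => k; rewrite ?inE // ffunE eqxx.
  transitivity (\sum_(f : wreath_base gT m) w (f ord0))%N; last first.
    by rewrite (reindex_inj (psi_inj tc)).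
  pose G i (y : gT) := if i == ord0 :> 'I_m then w y else 1%N.
  transitivity (\sum_(f : {ffun 'I_m -> gT}) \prod_i G i (f i))%N; last first.
    apply: eq_bigr => f _; rewrite (bigD1 ord0) //= big1 ?muln1 // => i.
    by rewrite /G => /negbTE->.
  rewrite -bigA_distr_bigA /= (bigD1 ord0) //= mulnC; congr (_ * _)%N.
  rewrite (eq_bigr (fun _ => #|gT|)) => [|i i0].
    by rewrite prod_nat_const cardC1 card_ord.
  by rewrite -sum1_card; apply: eq_bigr => y _; rewrite /G (negbTE i0).
apply: (@leq_trans (\sum_(H in N) \sum_(g in H | wtop g == c) F g)).
  rewrite (exchange_big_dep (fun g => wtop g == c)) /=; last by move=> H g _ /andP[].
  apply: leq_sum => g tg; have : g \in \bigcup_(H in N) (H : {set _}).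
    by rewrite coverN inE.
  by case/bigcupP=> H NH Hg; rewrite (bigD1 H) ?NH ?Hg ?tg //= leq_addr.
rewrite mulnC -sum_nat_const; apply: leq_sum => H NH.
case: (pickP [pred g in H | wtop g == c]) => [h0 /= /andP[Hh0 /eqP tc]|noh]; last first.
  by rewrite big_pred0.
rewrite (sum_coset tc _ Hh0) (eq_bigl (mem (base_part_group H))); last first.
  by move=> k; rewrite !inE.
have [fullT|prT] := eqVneq (dffun_morphism (fun _ : 'I_m => gT) ord0 @* base_part_group H) [set: gT].
  have [m1 cK] := card_base_part Hh0 tc simS nabS (properN H NH) fullT.
  have [k0 _] : exists2 k0, k0 \in [set: gT] & (forall y, w y <= w k0)%N.
    by case: (arg_maxnP w (erefl : xpredT (1 : gT))) => k0 _ kmax; exists k0 => // y; apply: kmax.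
  move=> wmax; apply: leq_trans (wdiag m1 k0); rewrite mulnC.
  apply: (@leq_trans (#|base_part_group H| * w k0)%N); last by rewrite leq_mul2r cK orbT.
  by rewrite -sum_nat_const; apply: leq_sum => k _; apply: wmax.
apply: leq_trans (weight_proj Hh0 tc w) _.
apply: wT; rewrite properT. exact: prT.
Qed.

Lemma weight_le_sigma (aT : finGroupType) (G : {group aT}) m (w : aT -> nat) B :
    0 < m -> simple G -> ~~ abelian G ->
    (~~ cyclic [set: wreath (subg_of G) m]) ->
    (forall T : {group aT}, T \proper G ->
      #|T| ^ m.-1 * \sum_(y in T) w y <= B)%N ->
    (1 < m -> forall y, y \in G -> w y * #|G| ^ m./2 <= B)%N ->
  (#|G| ^ m.-1 * \sum_(y in G) w y <= B * sigma [set: wreath (subg_of G) m]%G)%N.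
Proof.
move=> m_gt0 simG nabG ncW wT wdiag.
have isoG := isog_subg G.
have sumT (T : {set subg_of G}) : (\sum_(y in T) w (sgval y) = \sum_(y in sgval @* T) w y)%N.
  rewrite morphimEsub ?subsetT // big_imset //= => x y _ _; exact: val_inj.
have cG : #|[set: subg_of G]| = #|G| by rewrite (card_isog isoG).
have imG : sgval @* [set: subg_of G] = G by rewrite im_sgval.
have := @weight_le_sigma_type (subg_of G) m (fun y => w (sgval y)) B m_gt0.
rewrite -(isog_simple isoG) -(isog_abelian isoG) => /(_ simG nabG ncW).
have -> : (\sum_(y : subg_of G) w (sgval y) = \sum_(y in [set: subg_of G]) w (sgval y))%N.
  by rewrite [RHS](eq_bigl predT) // => y; rewrite inE.
rewrite -cardsT cG.
rewrite sumT imG; apply=> [T prT|m1 y]; last by rewrite wdiag ?subgP.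
rewrite sumT -(card_injm (injm_sgval G) (subsetT T)) wT //=.
by have := injm_proper (injm_sgval G) (subsetT T) (subsetT [set: subg_of G]); rewrite prT imG.
Qed.

Lemma leq_expr a b e : a <= b -> a ^ e <= b ^ e.
Proof. by case: e => // e ab; rewrite leq_exp2r. Qed.

(** Half of the exponent m of g suffices to absorb P^m D, as P^2 D^2 <= g. *)
Lemma half_power_bound P D g m : 1 < m -> P ^ 2 * D ^ 2 <= g ->
  (P ^ m * D * g ^ m./2 <= g ^ m)%N.
Proof.
move=> m1 PDg; have [->|P_gt0] := posnP P; first by rewrite exp0n // ltnW.
have [->|D_gt0] := posnP D; first by rewrite muln0.
set h := uphalf m; have mh : m = (h + m./2)%N by rewrite /h uphalf_half; lia.
have h_gt0 : 0 < h by rewrite /h uphalf_half; lia.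
rewrite [X in (_ <= X)%N](congr1 (expn g) mh) expnD leq_mul2r; apply/orP; right.
apply: leq_trans (leq_expr h PDg); rewrite expnMn -!expnM leq_mul //.
  by rewrite leq_pexp2l // /h uphalf_half; lia.
by rewrite -{1}[D]expn1 leq_pexp2l //; lia.
Qed.

(** Give to an element y of the class of x i the weight N i ^ m |C_G(x i)|, which
    makes the total weight above c equal to |G|^m times the sum of the N i ^ m. No
    proper subgroup then captures weight more than |G|^m if each T either meets
    just one class, in the proportion 1 / N i that a point stabilizer of a
    transitive action on N i points has, or is small. *)
Lemma classes_le_sigma (aT : finGroupType) (G : {group aT}) m (I : finType)
    (x : I -> aT) (N : I -> nat) (P Z D : nat) :
    0 < m -> simple G -> ~~ abelian G ->
    (~~ cyclic [set: wreath (subg_of G) m]) ->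
    (forall i, #|'C_G[x i]| <= Z)%N -> (#|I| * Z <= D)%N ->
    (forall i, N i <= P)%N -> (P ^ 2 * D ^ 2 <= #|G|)%N ->
    (forall T : {group aT}, T \proper G ->
      (exists i0, forall i, T :&: x i ^: G != set0 ->
         [/\ i = i0, (#|T| * N i <= #|G|)%N
           & (#|T :&: x i ^: G| * N i <= #|x i ^: G|)%N])
      \/ (#|T| * P * D <= #|G|)%N) ->
    (forall i, x i \in G) ->
  (\sum_i N i ^ m <= sigma [set: wreath (subg_of G) m]%G)%N.
Proof.
case: m => // m' _ simG nabG ncW cZ IZ NP PD hT Gx; set m := m'.+1.
pose z i := #|'C_G[x i]|.
have zE i : (#|x i ^: G| * z i = #|G|)%N.
  by rewrite -index_cent1 mulnC -(Lagrange (subsetIl G 'C[x i])).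
pose w y := (\sum_i (y \in x i ^: G) * (N i ^ m * z i))%N.
have sumw (A : {set aT}) :
    (\sum_(y in A) w y = \sum_i #|A :&: x i ^: G| * (N i ^ m * z i))%N.
  rewrite exchange_big /=; apply: eq_bigr => i _; rewrite -big_distrl /=; congr (_ * _)%N.
  rewrite -sum1_card big_mkcond [RHS]big_mkcond /=; apply: eq_bigr => y _.
  by rewrite inE; case: (y \in A); case: (y \in _).
have G_gt0 := cardG_gt0 G.
rewrite -(leq_pmul2l (_ : 0 < #|G| ^ m)%N) ?expn_gt0 ?G_gt0 //.
apply: leq_trans (weight_le_sigma (w := w) (B := (#|G| ^ m)%N) _ simG nabG ncW _ _) => //.
- rewrite sumw !big_distrr /=; apply: leq_sum => i _.
  rewrite (setIidPr _) ?class_subG // [(N i ^ m * _)%N]mulnC.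
  by rewrite [(#|_ ^: _| * _)%N]mulnA zE mulnA -expnSr.
- move=> T prT; rewrite sumw; have [[i0 i0P]|bT] := hT T prT.
    rewrite (bigD1 i0) //= big1 ?addn0 => [|i ii0]; last first.
      have [->|/i0P[ei]] := eqVneq (T :&: x i ^: G) set0; first by rewrite cards0.
      by rewrite ei eqxx in ii0.
    have [->|/i0P[_ TN CN]] := eqVneq (T :&: x i0 ^: G) set0.
      by rewrite cards0 mul0n muln0.
    rewrite [X in (_ <= X)%N]expnSr -{2}(zE i0) [(N i0 ^ m)%N]expnSr.
    have -> : (#|T| ^ m' * (#|T :&: x i0 ^: G| * (N i0 ^ m' * N i0 * z i0)) =
      (#|T| * N i0) ^ m' * (#|T :&: x i0 ^: G| * N i0 * z i0))%N.
      by rewrite expnMn; lia.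
    by rewrite leq_mul ?leq_mul ?leq_expr.
  apply: (@leq_trans (#|T| ^ m' * \sum_(i : I) (#|T| * (P ^ m * Z)))%N).
    rewrite leq_mul2l; apply/orP; right; apply: leq_sum => i _.
    by rewrite leq_mul ?leq_mul ?leq_expr ?cZ // subset_leq_card ?subsetIl.
  rewrite sum_nat_const.
  have [D0|D_gt0] := posnP D.
    have -> : (#|I| * (#|T| * (P ^ m * Z)) = #|I| * Z * (#|T| * P ^ m))%N by lia.
    by move: IZ; rewrite D0 leqn0 => /eqP->; rewrite mul0n muln0.
  apply: leq_trans (leq_expr m bT).
  apply: (@leq_trans (#|T| ^ m' * (D * (#|T| * P ^ m)))%N).
    have -> : (#|I| * (#|T| * (P ^ m * Z)) = #|I| * Z * (#|T| * P ^ m))%N by lia.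
    by rewrite leq_mul2l leq_mul2r IZ !orbT.
  rewrite !expnMn (expnSr #|T|) (expnSr D).
  have -> : (#|T| ^ m' * (D * (#|T| * P ^ m)) = #|T| ^ m' * #|T| * P ^ m * (1 * D))%N by lia.
  by rewrite leq_mul2l leq_mul2r expn_gt0 D_gt0 !orbT.
move=> m1 y _; apply: leq_trans (half_power_bound m1 PD).
rewrite leq_mul2r; apply/orP; right.
apply: (@leq_trans (\sum_(i : I) (P ^ m * Z))%N).
  apply: leq_sum => i _; case: (y \in _); rewrite ?mul0n // mul1n.
  by rewrite leq_mul ?leq_expr ?cZ.
by rewrite sum_nat_const mulnCA leq_mul2l IZ orbT.
Qed.

(** * Primitive groups: theorems of Jordan and Bochert *)

Section Jordan.
Variables (T : finType) (G : {group {perm T}}).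
Implicit Types (a b c x y z : T) (s t : {perm T}).

Definition cycle3 a b c : {perm T} := tperm a b * tperm a c.

Lemma cycle3J s a b c : cycle3 a b c ^ s = cycle3 (s a) (s b) (s c).
Proof. by rewrite conjMg !tpermJ. Qed.

Lemma cycle3_rot a b c : a != c -> b != c -> cycle3 b c a = cycle3 a b c.
Proof.
by move=> ac bc; rewrite /cycle3 (tpermC b a) conjgC tpermJ tpermR tpermD.
Qed.

Lemma cycle3V a b c : (cycle3 a b c)^-1 = cycle3 a c b.
Proof. by rewrite invMg !tpermV. Qed.

Lemma cycle3E a b c : a != b -> a != c -> b != c ->
  [/\ cycle3 a b c a = b, cycle3 a b c b = c & cycle3 a b c c = a].
Proof.
move=> ab ac bc; rewrite !permM tpermL tpermR (tpermD ac bc) tpermR tpermL.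
by rewrite (tpermD ab) // eq_sym.
Qed.

Lemma cycle3D a b c x : a != x -> b != x -> c != x -> cycle3 a b c x = x.
Proof. by move=> ax bx cx; rewrite permM !tpermD. Qed.

(** Invariant under permuting a, b, c: the two 3-cycles on a 3-set are inverse
    to each other. *)
Definition tri a b c := [&& a != b, a != c, b != c & cycle3 a b c \in G].

Lemma tri_rot a b c : tri a b c -> tri b c a.
Proof.
case/and4P=> ab ac bc; rewrite -cycle3_rot // /tri => ->.
by rewrite bc eq_sym ab eq_sym ac.
Qed.

Lemma tri_swap a b c : tri a b c -> tri a c b.
Proof.
by case/and4P=> ab ac bc; rewrite -groupV cycle3V /tri => ->; rewrite ab ac eq_sym bc.
Qed.

Lemma triJ s a b c : s \in G -> tri a b c -> tri (s a) (s b) (s c).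
Proof.
move=> Gs /and4P[ab ac bc Gabc].
by rewrite /tri !(inj_eq perm_inj) ab ac bc -cycle3J groupJ.
Qed.

(** The 3-cycle on b, a, x carries {b, c, x} to {a, c, b}. *)
Lemma tri_share2 a b c x : a != c -> tri a b x -> tri b c x -> tri a b c.
Proof.
move=> ac T1 T2; case/and4P: (T2) => bc bx cx _.
have /and4P[ba bx' ax Gu] := tri_swap (tri_rot T1).
have [ub ua ux] := cycle3E ba bx' ax.
have uc : cycle3 b a x c = c by apply: cycle3D => //; rewrite eq_sym.
have := triJ Gu T2; rewrite ub uc ux => /tri_swap.
by [].
Qed.

(** When the two triples have only b in common, the 3-cycle on b, c, y carries
    {a, b, x} to {a, c, x}, which shares a and x with {a, b, x}. *)
Lemma tri_join a b c x y : a != c -> tri a b x -> tri b c y -> tri a b c.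
Proof.
move=> ac T1 T2; have [exy | xy] := eqVneq x y.
  by apply: tri_share2 ac T1 _; rewrite exy.
have [exc | xc] := eqVneq x c; first by rewrite -exc.
have [eya | ya] := eqVneq y a; first by rewrite eya in T2; apply: tri_rot (tri_rot _).
case/and4P: (T1) => ab ax bx _; case/and4P: (T2) => bc b_y cy Gu.
have [ub uc uy] := cycle3E bc b_y cy.
have ua : cycle3 b c y a = a by apply: cycle3D; rewrite // eq_sym.
have ux : cycle3 b c y x = x by apply: cycle3D; rewrite // eq_sym.
have := triJ Gu T1; rewrite ua ub ux => T3.
apply: tri_rot; apply: tri_rot; apply: tri_swap.
exact: tri_share2 bc (tri_swap (tri_rot T1)) T3.
Qed.

(** A product of two transpositions is a product of 3-cycles, and an even
    permutation is a product of an even number of transpositions. *)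
Lemma all_tri_sub_Alt : (forall a b c, a != b -> a != c -> b != c -> tri a b c) ->
  'Alt_T \subset G.
Proof.
move=> Gtri; have G2 a b c d : a != b -> c != d -> tperm a b * tperm c d \in G.
  have G3 u v w : u != v -> u != w -> tperm u v * tperm u w \in G.
    have [-> _ _|vw uv uw] := eqVneq v w; first by rewrite tperm2 group1.
    by case/and4P: (Gtri u v w uv uw vw).
  move=> ab; have [<- ad|ac] := eqVneq a c; first by rewrite G3.
  have [<- _|ad cd] := eqVneq a d; first by rewrite (tpermC c a) G3.
  rewrite -[tperm a b]mulg1 -(tperm2 a c) -!mulgA mulgA groupM ?G3 //.
  by rewrite (tpermC a c) G3 // eq_sym.
apply/subsetP=> s; rewrite Alt_even.
have [ts -> dts] := prod_tpermP s.
rewrite odd_perm_prod //.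
elim: {ts}_.+1 {-2}ts (ltnSn (size ts)) dts => // n IHn [|t1 [|t2 ts]] //=.
  by rewrite big_nil group1.
rewrite !ltnS => lt_n /and3P[d1 d2 dts]; rewrite negbK => ev.
rewrite !big_cons mulgA groupM ?G2 //; apply: IHn => //; exact: leq_trans lt_n.
Qed.

(** Being equal or moved by a common 3-cycle of G is a G-invariant equivalence
    relation, transitive by tri_join. As it is not equality, primitivity forces
    it to relate all points, and tri_join then yields all 3-cycles. *)
Lemma primitive_cycle3 a b c : [primitive G, on setT | 'P] -> tri a b c ->
  'Alt_T \subset G.
Proof.
move=> /andP[_ primG] Tabc.
pose R x y := (x == y) || [exists z, tri x y z].
have Rtrans x y z : R x y -> R y z -> R x z.
  rewrite /R; have [<- //|xy] := eqVneq x y.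
  have [<- Txy _|yz] := eqVneq y z; first by apply/orP; right.
  have [//|xz] := eqVneq x z; rewrite /= => /existsP[u Txy] /existsP[v Tyz].
  by apply/existsP; exists y; apply/tri_swap/(tri_join xz Txy Tyz).
have Rsym x y : R x y -> R y x.
  rewrite /R [y == x]eq_sym; case: eqVneq => //= _ /existsP[z Txy].
  by apply/existsP; exists z; apply/tri_swap/tri_rot.
have Req : {in setT & &, equivalence_rel R}.
  move=> x y z _ _ _; split=> [|Rxy]; first by rewrite /R eqxx.
  apply/idP/idP; first by apply: Rtrans; apply: Rsym.
  exact: Rtrans.
have RJ s x y : s \in G -> R x y -> R (s x) (s y).
  move=> Gs /orP[/eqP->|/existsP[z Txy]]; first by rewrite /R eqxx.
  by apply/orP; right; apply/existsP; exists (s z); apply: triJ.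
have parP := equivalence_partitionP Req.
set P := equivalence_partition R setT in parP.
have Pb x y : (y \in pblock P x) = R x y.
  by rewrite pblock_equivalence_partition ?inE.
have coverP : cover P = setT := cover_partition parP.
have Pmem x : pblock P x \in P by rewrite pblock_mem // coverP inE.
have actP : [acts G, on P | 'P^*].
  suffices sub s B : s \in G -> B \in P -> 'P^*%act B s \in P.
    apply/actsP=> s Gs B; apply/idP/idP=> [Ps|]; last exact: sub.
    by rewrite -(actK 'P^* s B) sub ?groupV.
  move=> Gs PB; have /set0Pn[x Bx] := partition_neq0 parP PB.
  have <- : pblock P x = B by apply: def_pblock => //; apply: partition_trivIset parP.
  suffices -> : 'P^*%act (pblock P x) s = pblock P (s x) by [].
  apply/setP=> y; rewrite Pb; apply/imsetP/idP=> [[z]|Rxy].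
    by rewrite Pb => Rxz ->; apply: RJ.
  exists (s^-1 y); last by rewrite /= apermE permKV.
  by rewrite Pb -[x](permK s) RJ ?groupV.
have Runiv x y : R x y.
  have [Tab|] := boolP (#|P| <= 1).
    have : #|P| == 1%N by rewrite eqn_leq Tab; apply/card_gt0P; exists (pblock P x).
    case/cards1P=> B PB; rewrite -Pb.
    have /set1P-> : pblock P x \in [set B] by rewrite -PB.
    by have /set1P <- : pblock P y \in [set B]; rewrite -?PB // mem_pblock coverP inE.
  rewrite -ltnNge => P1; case/negP: primG; apply/existsP; exists P.
  rewrite /imprimitivity_system parP actP P1 /=.
  rewrite (card_partition parP).
  rewrite -sum1_card; have Pa := Pmem a.
  rewrite (bigD1 _ Pa) [X in _ < X](bigD1 _ Pa) /=.
  rewrite -addSn leq_add //; last first.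
    by apply: leq_sum => B /andP[PB _]; rewrite card_gt0 (partition_neq0 parP).
  have ab : a != b by case/and4P: Tabc.
  suffices : [set a; b] \subset pblock P a by move/subset_leq_card; rewrite cards2 ab.
  rewrite subUset !sub1set !Pb /R eqxx /=; apply/orP; right.
  by apply/existsP; exists c.
apply: all_tri_sub_Alt => x y z xy xz yz.
have := Runiv x y; have := Runiv y z; rewrite /R (negbTE xy) (negbTE yz) /=.
by move=> /existsP[v Tyz] /existsP[u Txy]; apply: tri_join Txy Tyz.
Qed.
End Jordan.

(** Off x, each of s and t fixes what the other one moves, so [~ s, t] moves
    nothing but x, t x and s x. *)
Lemma commg_supports1 (T : finType) (s t : {perm T}) (A B : {set T}) x :
    perm_on A s -> perm_on B t -> A :&: B = [set x] -> s x != x -> t x != x ->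
  [~ s, t] = cycle3 x (t x) (s x).
Proof.
move=> sA tB AB sx tx.
have Ax : x \in A by apply: contraNT sx => /(out_perm sA)->.
have Bx : x \in B by apply: contraNT tx => /(out_perm tB)->.
have nAB y : y \in A -> y \in B -> y = x.
  by move=> Ay By; apply/set1P; rewrite -AB inE Ay.
have As : s x \in A by rewrite perm_closed.
have Bt : t x \in B by rewrite perm_closed.
have fs y : y \notin A -> s y = y by move/(out_perm sA).
have ft y : y \notin B -> t y = y by move/(out_perm tB).
have sxB : s x \notin B by apply: contra sx => sxB; rewrite (nAB _ As sxB).
have txA : t x \notin A by apply: contra tx => txA; rewrite (nAB _ txA Bt).
have sV : forall y, (y \in A) = (s^-1 y \in A) by move=> y; rewrite perm_closed // perm_onV.
have tV : forall y, (y \in B) = (t^-1 y \in B) by move=> y; rewrite perm_closed // perm_onV.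
have fsV y : y \notin A -> s^-1 y = y by move=> yA; rewrite -{1}[y]fs // permK.
have ftV y : y \notin B -> t^-1 y = y by move=> yB; rewrite -{1}[y]ft // permK.
have sxV : s^-1 x != x by apply: contra sx => /eqP {1}<-; rewrite permKV.
have txV : t^-1 x != x by apply: contra tx => /eqP {1}<-; rewrite permKV.
have tsx : t x != s x by apply: contraNneq sxB => <-.
have [Cx Ct Cs] : [/\ cycle3 x (t x) (s x) x = t x, cycle3 x (t x) (s x) (t x) = s x
    & cycle3 x (t x) (s x) (s x) = x] by apply: cycle3E; rewrite // eq_sym.
have notB y : y \in A -> y != x -> y \notin B by move=> Ay; apply: contra => /(nAB _ Ay)->.
have notA y : y \in B -> y != x -> y \notin A by move=> By; apply: contra => /nAB->.
have E y : [~ s, t] y = t (s (t^-1 (s^-1 y))) by rewrite !permM.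
apply/permP=> y; rewrite E.
have [->|yx] := eqVneq y x; first by rewrite Cx ftV ?permKV // notB -?sV.
have [->|ytx] := eqVneq y (t x); first by rewrite Ct fsV // permK ft.
have [->|ysx] := eqVneq y (s x).
  by rewrite Cs permK fs ?permKV // notA -?tV.
rewrite cycle3D 1?eq_sym //.
have sVyx : s^-1 y != x by apply: contra ysx => /eqP<-; rewrite permKV.
have tVyx : t^-1 y != x by apply: contra ytx => /eqP<-; rewrite permKV.
have [Ay|nAy] := boolP (y \in A).
  by rewrite (ftV (s^-1 y)) ?permKV ?ft ?notB -?sV.
rewrite (fsV y) //; have [By|nBy] := boolP (y \in B).
  by rewrite fs ?permKV ?notA -?tV.
by rewrite (ftV y) // fs // ft.
Qed.

(** Let D be a largest set such that only 1 in G is supported in D. The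
    permutations supported in D lie in distinct cosets of G, so it is enough to
    show that D contains half of the points. Otherwise the complement of D is
    larger than D, whence some s <> 1 in G is supported there; if s moves x, some
    t <> 1 in G is supported in x |: D, and t moves x. The supports of s and t
    share just x, so G contains a 3-cycle. *)
Lemma Bochert (T : finType) (G : {group {perm T}}) :
    [primitive G, on setT | 'P] -> ~~ ('Alt_T \subset G) ->
  #|G| * (uphalf #|T|)`! <= #|T|`!.
Proof.
move=> primG nAG.
pose free (D : {set T}) := [forall s in G, perm_on D s ==> (s == 1)].
have free0 : free set0.
  by apply/forall_inP=> s _; apply/implyP=> /perm_on_id->; rewrite ?cards0.
case: (arg_maxnP (fun D : {set T} => #|D|) free0) => D freeD maxD.
have TI : G :&: perm.Sym D = 1.
  apply/trivgP/subsetP=> s /setIP[Gs]; rewrite !inE => Ds.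
  exact: implyP (forall_inP freeD s Gs) Ds.
have leD : uphalf #|T| <= #|D|.
  rewrite leqNgt; apply/negP=> ltD.
  have notfree (E : {set T}) : #|D| < #|E| ->
      exists s, [/\ s \in G, perm_on E s & s != 1].
    move=> ltE; have : ~~ free E by apply: contraL ltE => /maxD; rewrite -leqNgt.
    by case/forall_inPn=> s Gs; rewrite negb_imply => /andP[]; exists s.
  have ltCD : #|D| < #|~: D| by move: ltD (cardsC D); rewrite uphalf_half; lia.
  have [s [Gs sC s1]] := notfree _ ltCD.
  have [x sx] : exists x, s x != x.
    apply/existsP; apply: contraNT s1 => /existsPn fixs.
    by apply/eqP/permP=> x; rewrite perm1; apply/eqP; have := fixs x; rewrite negbK.
  have Cx : x \in ~: D by apply: contraNT sx => /(out_perm sC)->.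
  have nDx : x \notin D by rewrite inE in Cx.
  have ltxD : #|D| < #|x |: D| by rewrite cardsU1 nDx.
  have [t [Gt tD t1]] := notfree _ ltxD.
  have tx : t x != x.
    apply: contra t1 => /eqP tx; apply: (implyP (forall_inP freeD t Gt)).
    apply/subsetP=> y ty; have := subsetP tD y ty; rewrite !inE.
    by case: eqP ty => //= ->; rewrite inE tx eqxx.
  have CD : ~: D :&: (x |: D) = [set x].
    apply/setP=> y; rewrite !inE; case: (eqVneq y x) => [->|_] /=; first by rewrite nDx.
    by rewrite andNb.
  have Gst := commg_supports1 sC tD CD sx tx.
  case/negP: nAG; apply: (primitive_cycle3 primG (a := x) (b := t x) (c := s x)).
  have sxC : s x \in ~: D by rewrite perm_closed.
  have txD : t x \in x |: D by rewrite perm_closed // setU11.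
  rewrite /tri ![x == _]eq_sym sx tx -Gst groupR // andbT.
  apply: contraNneq sx => tsx; apply/eqP/set1P; rewrite -CD inE sxC.
  by rewrite -tsx.
have -> : #|T|`! = #|[set: {perm T}]|.
  rewrite -cardsT -perm.card_Sym; apply: eq_card => s.
  by rewrite !inE; apply/subsetP=> x _; rewrite inE.
rewrite (leq_trans _ (subset_leq_card (subsetT (G * perm.Sym D)))) // TI_cardMg //.
by rewrite leq_mul // perm.card_Sym leq_fact.
Qed.

(** * Transitivity of the alternating group and permutations with few orbits *)

Lemma coloring_Sym n (I : eqType) (f g : 'I_n -> I) :
    (forall i, #|[set x | f x == i]| = #|[set x | g x == i]|) ->
  exists s : 'S_n, forall x, f x = g (s x).
Proof.
move=> fg; have cF (h : 'I_n -> I) i : count_mem i [tuple h x | x < n] = #|[set x | h x == i]|.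
  by rewrite cardsE cardE /enum_mem size_filter /= count_map enumT; apply: eq_count.
have : perm_eq [tuple f x | x < n] [tuple g x | x < n].
  by apply/allP=> i _ /=; rewrite !cF fg.
case/tuple_permP=> s /val_inj fs; exists s => x.
by have := congr1 (fun t => tnth t x) fs; rewrite !tnth_mktuple.
Qed.

(** Precomposing with the transposition of two points of the same colour changes
    the parity of the permutation and not the colouring. *)
Lemma coloring_Alt n (I : eqType) (f g : 'I_n -> I) x y :
    (forall i, #|[set x | f x == i]| = #|[set x | g x == i]|) ->
    x != y -> f x = f y ->
  exists2 s : 'S_n, s \in 'Alt_('I_n) & forall x, f x = g (s x).
Proof.
move=> /coloring_Sym[s fgs] xy fxy.
have [odd_s|even_s] := boolP (odd_perm s); last first.
  by exists s; rewrite ?Alt_even.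
exists (tperm x y * s); first by rewrite Alt_even odd_permM odd_tperm xy odd_s.
by move=> z; rewrite permM -fgs; case: tpermP => // ->.
Qed.

(** A permutation that commutes with g is determined by its values on one point
    of each orbit of g. *)
Lemma card_cent_orbits (T : finType) (g : {perm T}) r (t : r.-tuple T) :
  (forall x, exists i, x \in porbit g (tnth t i)) -> #|'C[g]| <= #|T| ^ r.
Proof.
move=> cov; pose F (s : {perm T}) := [ffun i => s (tnth t i)].
have injF : {in 'C[g] &, injective F}.
  move=> s u /cent1P Cs /cent1P Cu /ffunP Fsu; apply/permP=> x.
  have [i /porbitP[k ->]] := cov x.
  have := Fsu i; rewrite !ffunE => E.
  have cX (v : {perm T}) : commute g v -> v ((g ^+ k) (tnth t i)) = (g ^+ k) (v (tnth t i)).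
    by move=> cgv; rewrite -!permM; congr (fun_of_perm _ _); rewrite (commuteX k (commute_sym cgv)).
  by rewrite !cX ?E.
rewrite -(card_in_imset injF) (leq_trans (max_card _)) //.
by rewrite card_ffun card_ord.
Qed.

(** One full turn inside A and one inside its complement. *)
Definition turn_fun (T : finType) (A : {set T}) x : T :=
  next (enum (if x \in A then A else ~: A)) x.

Section TwoCycles.
Variables (T : finType) (A : {set T}).

Lemma turn_fun_inj : injective (turn_fun A).
Proof.
pose back x := prev (enum (if x \in A then A else ~: A)) x.
apply: (can_inj (g := back)) => x; rewrite /back /turn_fun.
have mem_turn (B : {set T}) : x \in B -> next (enum B) x \in B.
  by move=> Bx; rewrite -mem_enum mem_next mem_enum.
case: (boolP (x \in A)) => Ax; first by rewrite mem_turn // prev_next // enum_uniq.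
have Cx : x \in ~: A by rewrite inE.
by have := mem_turn _ Cx; rewrite inE => /negbTE->; rewrite prev_next // enum_uniq.
Qed.

Definition turn : {perm T} := perm turn_fun_inj.

Lemma turn_orbit x : porbit turn x = if x \in A then A else ~: A.
Proof.
set B := if _ then _ else _; have Bx : x \in B by rewrite /B; case: ifP; rewrite // inE => ->.
have BE y : y \in B -> turn y = next (enum B) y.
  rewrite permE /turn_fun /B; case: (ifP (x \in A)) => _; first by move->.
  by rewrite inE => /negbTE->.
have sB k : (turn ^+ k) x \in B.
  elim: k => [|k IHk]; first by rewrite expg0 perm1.
  by rewrite expgSr permM BE // -mem_enum mem_next mem_enum.
apply/setP=> y; apply/porbitP/idP => [[k ->] //|By].
have cycB := cycle_next (enum_uniq (mem B)).
have : fconnect (next (enum B)) x y.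
  by rewrite (fconnect_cycle cycB) ?mem_enum.
case/iter_findex; set k := findex _ _ _ => <-; exists k.
elim: k => //= [|k ->]; first by rewrite perm1.
by rewrite expgSr permM BE.
Qed.

End TwoCycles.

(** * Partitions into blocks of equal size *)

Section UniqueFixedPoint.
Variables (aT : finGroupType) (rT : finType) (to : {action aT &-> rT}).
Variables (G T : {group aT}) (O : {set rT}) (x : aT) (Q : rT).
Hypotheses (trO : [transitive G, on O | to]) (OQ : Q \in O).
Hypotheses (sTQ : T \subset 'C_G[Q | to]).

Lemma stab_index_bound : #|T| * #|O| <= #|G|.
Proof.
rewrite -(card_orbit_stab to G Q) (atransP trO) // mulnC leq_mul2l.
by rewrite subset_leq_card ?orbT.
Qed.

(** Double counting: all stabilizers of points of O meet the class of x in the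
    same number of elements, and they do so disjointly. *)
Lemma stab_class_bound :
    (forall y Q1 Q2, y \in x ^: G -> Q1 \in O -> Q2 \in O ->
       y \in 'C[Q1 | to] -> y \in 'C[Q2 | to] -> Q1 = Q2) ->
  #|T :&: x ^: G| * #|O| <= #|x ^: G|.
Proof.
move=> uniqQ; set C := x ^: G.
have cQ Q' : Q' \in O -> #|C :&: 'C[Q' | to]| = #|C :&: 'C[Q | to]|.
  move=> OQ'; have [a Ga ->] := atransP2 trO OQ OQ'.
  have CJ : C = C :^ a by apply/esym/normP; apply: subsetP (class_norm x G) a Ga.
  by rewrite astab1_act {1}CJ -conjIg cardJg.
apply: (@leq_trans (#|C :&: 'C[Q | to]| * #|O|)).
  rewrite leq_mul2r setIC subset_leq_card ?orbT // setIS //.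
  by rewrite (subset_trans sTQ) // subsetIr.
rewrite mulnC -sum_nat_const (eq_bigr (fun Q' => #|C :&: 'C[Q' | to]|)) => [|Q' OQ'];
  last by rewrite cQ.
rewrite (eq_bigr (fun Q' => \sum_(y in C) (y \in 'C[Q' | to]))) => [|Q' _]; last first.
  rewrite -sum1_card big_mkcond [RHS]big_mkcond /=; apply: eq_bigr => y _.
  by rewrite in_setI; case: (y \in C); case: (y \in _).
rewrite exchange_big /= -sum1_card; apply: leq_sum => y Cy.
have [Q1 /andP[OQ1 yQ1]|none] := pickP [pred Q1 in O | y \in 'C[Q1 | to]].
  rewrite (bigD1 Q1) //= yQ1 big1 // => Q2 /andP[OQ2 ne].
  apply/eqP; rewrite eqb0; apply: contra ne => yQ2; apply/eqP.
  exact: (uniqQ y).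
by rewrite big1 // => Q1 OQ1; have := none Q1; rewrite /= OQ1 /= => ->.
Qed.

End UniqueFixedPoint.

Definition equipartitions n k b : {set {set {set 'I_n}}} :=
  [set Q | [&& partition Q [set: 'I_n], #|Q| == k & [forall B in Q, #|B| == b]]].

Section Equipartitions.
Variables (n k b : nat).
Local Notation EP := (equipartitions n k b).
Implicit Types (Q : {set {set 'I_n}}).

Lemma equipartition_size Q : Q \in EP -> (k * b)%N = n.
Proof.
rewrite inE => /and3P[pQ /eqP <- /forall_inP bQ].
rewrite -[n in RHS]card_ord -cardsT (@card_uniform_partition _ b Q) // => B QB.
exact/eqP/bQ.
Qed.

Lemma equipartition_coloring Q : Q \in EP ->
  exists2 f : 'I_n -> 'I_k, forall i, #|[set x | f x == i]| = b
    & Q = [set [set y | f y == i] | i : 'I_k].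
Proof.
rewrite inE => /and3P[pQ /eqP cQ /forall_inP bQ].
have covQ := cover_partition pQ; have tiQ := partition_trivIset pQ.
have Qx x : pblock Q x \in Q by rewrite pblock_mem // covQ inE.
have rQ B : B \in Q -> (index B (enum Q) < k)%N by rewrite -cQ cardE index_mem mem_enum.
pose f x := Ordinal (rQ _ (Qx x)).
have idx_inj : {in Q &, injective (index^~ (enum Q))}.
  move=> B C QB QC eBC; rewrite -[B](nth_index set0 (_ : B \in enum Q)) ?mem_enum //.
  by rewrite eBC nth_index ?mem_enum.
have fib B (QB : B \in Q) : [set y | f y == Ordinal (rQ B QB)] = B.
  apply/setP=> y; rewrite inE -val_eqE /=.
  apply/eqP/idP=> [/(idx_inj _ _ (Qx y) QB) <-|By].
    by rewrite mem_pblock covQ inE.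
  by rewrite (def_pblock tiQ QB By).
have surj (i : 'I_k) : {B | (B \in Q) & index B (enum Q) = i}.
  have i_lt : (i < size (enum Q))%N by rewrite -cardE cQ.
  exists (nth set0 (enum Q) i); first by rewrite -mem_enum mem_nth.
  by rewrite index_uniq ?enum_uniq.
have fibi i : [set y | f y == i] \in Q.
  have [B QB iB] := surj i; suffices -> : i = Ordinal (rQ B QB) by rewrite fib.
  exact/val_inj/esym.
exists f => [i|]; first exact/eqP/bQ.
apply/setP=> B; apply/idP/imsetP=> [QB|[i _ ->] //].
by exists (Ordinal (rQ B QB)); rewrite ?inE // fib.
Qed.

Lemma coloring_setact (s : 'S_n) (I : finType) (f g : 'I_n -> I) : (forall x, f x = g (s x)) ->
  'P^*^*%act [set [set y | f y == i] | i : I] s = [set [set y | g y == i] | i : I].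
Proof.
move=> fgs; rewrite /= /setact -imset_comp; apply: eq_imset => i /=.
apply/setP=> y; rewrite inE; apply/imsetP/idP => [[x]|gy].
  by rewrite inE fgs => fx ->.
by exists (s^-1 y); rewrite ?inE ?fgs /= ?apermE permKV.
Qed.

Lemma setact_equipartitions (s : 'S_n) Q : Q \in EP -> 'P^*^*%act Q s \in EP.
Proof.
rewrite !inE => /and3P[pQ /eqP cQ /forall_inP bQ].
rewrite card_setact cQ eqxx; apply/andP; split; last first.
  by apply/forall_inP=> _ /imsetP[B QB ->]; rewrite card_setact bQ.
have <- : s @: [set: 'I_n] = setT.
  by apply/setP=> x; rewrite inE; apply/imsetP; exists (s^-1 x); rewrite ?inE ?permKV.
by have := imset_partition Q setT (@perm_inj _ s); rewrite pQ.
Qed.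

(** Blocks can be matched by a permutation, whose parity can be corrected inside
    a block of size at least 2. *)
Lemma Alt_trans_equipartitions Q0 : (0 < k)%N -> (1 < b)%N -> Q0 \in EP ->
  [transitive 'Alt_('I_n), on EP | 'P^*^*].
Proof.
move=> k0 b1 EQ0.
apply/imsetP; exists Q0 => //; apply/setP=> Q; apply/idP/imsetP=> [EQ|[s _ ->]]; last exact: setact_equipartitions.
have [f cf ->] := equipartition_coloring EQ0.
have [g cg ->] := equipartition_coloring EQ.
have : (1 < #|[set x | f x == Ordinal k0]|)%N by rewrite cf.
case/card_gt1P=> x [y [fx fy xy]].
rewrite !inE in fx fy.
have [s As fgs] := coloring_Alt (fun i => etrans (cf i) (esym (cg i))) xy (etrans (eqP fx) (esym (eqP fy))).
by exists s => //; rewrite (coloring_setact fgs).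
Qed.

Lemma card_equipartitions_le : #|EP| <= k ^ n.
Proof.
pose P (f : {ffun 'I_n -> 'I_k}) : {set {set 'I_n}} := [set [set y | f y == i] | i : 'I_k].
have sEP : EP \subset P @: setT.
  apply/subsetP=> Q /equipartition_coloring[f _ ->].
  apply/imsetP; exists [ffun x => f x]; rewrite ?inE //.
  by apply: eq_imset => i; apply/setP=> y; rewrite !inE ffunE.
rewrite (leq_trans (subset_leq_card sEP)) // (leq_trans (leq_imset_card _ _)) //.
by rewrite cardsT card_ffun !card_ord.
Qed.

End Equipartitions.

(** * Stabilizers of partitions and of subsets *)

Lemma card_color_stab (T : finType) k b (f : T -> 'I_k) (K : {set {perm T}}) :
    (forall i, #|[set x | f x == i]| = b) ->
    (forall s x, s \in K -> f (s x) = f x) ->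
  (#|K| <= b`! ^ k)%N.
Proof.
move=> cf fK; pose fib i := [set x | f x == i].
pose F (s : {perm T}) := [ffun i => restr_perm (fib i) s].
have sN s i : s \in K -> s \in 'N(fib i | 'P).
  move=> Ks; apply/astabsP=> x; by rewrite !inE /= apermE fK.
have injF : {in K &, injective F}.
  move=> s t Ks Kt /ffunP/= E; apply/permP=> x.
  have := E (f x); rewrite !ffunE => /permP/(_ x).
  by rewrite !restr_permE ?sN ?inE.
rewrite -(card_in_imset injF).
apply: (@leq_trans #|family (fun i => mem (perm_on (fib i)))|).
  apply: subset_leq_card; apply/subsetP=> _ /imsetP[s Ks ->].
  by apply/familyP=> i; rewrite ffunE; apply: restr_perm_on.
have -> : #|family (fun i => mem (perm_on (fib i)))| =
          (\prod_(i < k) \sum_(s in perm_on (fib i)) 1)%N.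
  by rewrite bigA_distr_big_dep /= -sum1_card; apply: eq_bigr => h _; rewrite big1.
rewrite (eq_bigr (fun _ => b`!)) => [|i _]; first by rewrite prod_nat_const card_ord.
by rewrite sum1_card card_perm cf.
Qed.

(** The kernel of the action of T on the k blocks permutes the points of each
    block separately. *)
Lemma card_acts_equipartition n k b (Q : {set {set 'I_n}}) (T : {group 'S_n}) :
    Q \in equipartitions n k b -> T \subset 'N(Q | 'P^*) ->
  (#|T| <= b`! ^ k * k`!)%N.
Proof.
move=> EQ actT; have [f cf defQ] := equipartition_coloring EQ.
have nQT : actby_cond T Q ('P^*) by [].
have := card_morphim (actperm_morphism <[nQT]>) T; rewrite setIid => im.
rewrite -(LagrangeI T ('ker (actperm_morphism <[nQT]>))) -im leq_mul //.
  apply: (@card_color_stab _ k b f) => // s x /setIP[Ts ks].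
  have : s \in 'C(setT | <[nQT]>) by rewrite -ker_actperm; exact: ks.
  rewrite astab_actby setIT => /setIP[_ /astabP fixQ].
  apply/eqP; have := fixQ [set y | f y == f x].
  rewrite defQ imset_f // => /(_ isT) /setP/(_ (s x)).
  rewrite !inE => <-; apply/imsetP; exists x; by rewrite ?inE.
have cQ : #|Q| = k by move: EQ; rewrite inE => /and3P[_ /eqP].
rewrite -[X in X`!]cQ -card_perm subset_leq_card //.
apply/subsetP=> _ /morphimP[s _ Ts ->]; apply/subsetP=> B.
rewrite inE actpermE; apply: contraR => nQB.
by rewrite /= /actby (negbTE nQB).
Qed.

Section Subsets.
Variables (n i : nat).
Definition subsets_of : {set {set 'I_n}} := [set A : {set 'I_n} | #|A| == i].

Lemma card_subsets_of : #|subsets_of| = 'C(n, i).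
Proof. by rewrite card_draws card_ord. Qed.

Lemma Alt_trans_subsets : 2 < n -> i <= n -> [transitive 'Alt_('I_n), on subsets_of | 'P^*].
Proof.
move=> n2 le_in.
have [A0 A0i] : exists A : {set 'I_n}, A \in subsets_of.
  apply/card_gt0P; rewrite card_subsets_of bin_gt0 //.
apply/imsetP; exists A0 => //; apply/setP=> A; apply/idP/imsetP=> [|[s _ ->]]; last first.
  by rewrite inE card_setact; move: A0i; rewrite inE.
move: A0i; rewrite !inE => /eqP cA0 /eqP cA.
have [x [y [xy eA]]] : exists x y, x != y /\ (x \in A0) = (y \in A0).
  have [A1|A1] := leqP 2 #|A0|.
    by have /card_gt1P[x [y [xA yA xy]]] := A1; exists x, y; rewrite xA yA.
  have : (1 < #|~: A0|)%N by have := cardsC A0; rewrite card_ord; lia.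
  case/card_gt1P=> x [y []]; rewrite !inE => xA yA xy; exists x, y.
  by rewrite (negbTE xA) (negbTE yA).
have fib (B C : {set 'I_n}) : #|B| = #|C| -> forall j,
    #|[set x | (x \in B) == j]| = #|[set x | (x \in C) == j]|.
  move=> BC j; have E (D : {set 'I_n}) : [set x | (x \in D) == j] = if j then D else ~: D.
    by apply/setP=> z; rewrite inE; case: j; rewrite ?inE ?eqb_id ?eqbF_neg.
  by rewrite !E; case: (j) => //; have := cardsC B; have := cardsC C; lia.
have [s As sA] := coloring_Alt (fib A0 A (etrans cA0 (esym cA))) xy eA.
exists s => //; apply/setP=> z; apply/idP/imsetP=> [Az|[u Au ->]].
  by exists (s^-1 z); rewrite ?sA /= ?apermE permKV.
by rewrite /= apermE -sA.
Qed.
End Subsets.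

(** * Long cycles and permutations with two orbits *)

Section LongCycle.
Variables (n : nat) (g : 'S_n).
Hypothesis g_trans : forall x, porbit g x = [set: 'I_n].

Lemma long_cycle_order (x0 : 'I_n) : #[g] = n.
Proof.
apply/eqP; rewrite eqn_dvd order_dvdn; apply/andP; split.
  apply/eqP/permP=> x; have := iter_porbit g x.
  by rewrite g_trans cardsT card_ord -permX perm1.
have := dvdn_orbit 'P <[g]> x0; rewrite -porbitE g_trans cardsT card_ord.
by [].
Qed.

Lemma long_cycle_fix j x : (g ^+ j) x = x -> n %| j.
Proof.
move=> gjx; rewrite -(long_cycle_order x) order_dvdn; apply/eqP/permP=> y.
have /porbitP[i ->] : y \in porbit g x by rewrite g_trans inE.
by rewrite perm1 -!permM (commuteX2 _ _ (commute_refl g)) permM gjx.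
Qed.

Lemma card_porbitX k b x : (k * b)%N = n -> #|porbit (g ^+ k) x| = b.
Proof.
move=> kbn; have n_gt0 : 0 < n by case: (n) x => [[]|].
have k_gt0 : 0 < k by move: n_gt0; rewrite -kbn muln_gt0 => /andP[].
have kn : k %| n by rewrite -kbn dvdn_mulr.
have nk : n %/ k = b by rewrite -kbn mulKn.
apply/eqP; rewrite eqn_dvd; apply/andP; split.
  have := dvdn_orbit 'P <[g ^+ k]> x; rewrite -porbitE.
  rewrite -[#|<[_]>|]/#[_] orderXdiv (long_cycle_order x) ?nk //.
have := iter_porbit (g ^+ k) x; set t := #|_|; rewrite -permX -expgM.
by move/long_cycle_fix; rewrite -kbn dvdn_pmul2l.
Qed.

(** The k blocks are permuted cyclically by g, so g^k stabilizes each of them; as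
    the orbits of g^k already have the size b of a block, they are the blocks. *)
Lemma long_cycle_equipartition k b Q : Q \in equipartitions n k b ->
  g \in 'N(Q | 'P^*) -> Q = porbits (g ^+ k).
Proof.
move=> EQ gQ; have kbn := equipartition_size EQ.
move: EQ; rewrite inE => /and3P[pQ /eqP cQ /forall_inP bQ].
have tiQ := partition_trivIset pQ; have covQ := cover_partition pQ.
have gX j B : B \in Q -> 'P^*%act B (g ^+ j) \in Q.
  by move=> QB; rewrite (astabs_act B (groupX j gQ)).
have orbB B x : B \in Q -> x \in B -> porbit (g ^+ k) x = B.
  move=> QB Bx; pose sg := actperm 'P^* g.
  have sgX j : (sg ^+ j) B = 'P^*%act B (g ^+ j).
    by rewrite -[sg ^+ j](morphX (actperm_morphism 'P^*)) ?inE //= actpermE.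
  have orbQ : porbit sg B = Q.
    apply/setP=> C; apply/porbitP/idP=> [[j ->]|QC]; first by rewrite sgX gX.
    have [y Cy] := set0Pn _ (partition_neq0 pQ QC).
    have /porbitP[j def_y] : y \in porbit g x by rewrite g_trans inE.
    exists j; rewrite sgX -(def_pblock tiQ QC Cy); apply/esym/esym/def_pblock => //.
      exact: gX.
    by rewrite def_y; apply: (mem_setact 'P).
  have := iter_porbit sg B; rewrite orbQ cQ -permX sgX => gkB.
  apply/eqP; rewrite eqEcard (card_porbitX x kbn) (eqP (bQ B QB)) leqnn andbT.
  apply/subsetP=> _ /porbitP[j ->]; elim: j => [|j IHj]; first by rewrite expg0 perm1.
  by rewrite expgSr permM -gkB; apply: (mem_setact 'P).
apply/setP=> B; apply/idP/imsetP=> [QB|[x _ ->]].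
  have [x Bx] := set0Pn _ (partition_neq0 pQ QB).
  by exists x; rewrite ?(orbB B).
have xQ : x \in cover Q by rewrite covQ inE.
by rewrite (orbB (pblock Q x)) ?pblock_mem // mem_pblock.
Qed.

Lemma long_cycle_porbits k b : (k * b)%N = n -> 0 < n ->
  porbits (g ^+ k) \in equipartitions n k b /\ g \in 'N(porbits (g ^+ k) | 'P^*).
Proof.
move=> kbn n_gt0; set Q := porbits _.
have k_gt0 : 0 < k by move: n_gt0; rewrite -kbn muln_gt0 => /andP[].
have b_gt0 : 0 < b by move: n_gt0; rewrite -kbn muln_gt0 => /andP[].
have pQ : partition Q [set: 'I_n].
  have -> : Q = orbit 'P <[g ^+ k]> @: [set: 'I_n].
    by apply/setP=> B; apply/imsetP/imsetP=> -[x _ ->]; exists x; rewrite ?inE ?porbitE.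
  by apply: orbit_partition; apply/actsP=> a _ x; rewrite !inE.
have bQ B : B \in Q -> #|B| = b by case/imsetP=> x _ ->; apply: card_porbitX.
split.
  rewrite inE pQ /=; apply/andP; split; last by apply/forall_inP=> B /bQ->.
  have := @card_uniform_partition _ b Q setT bQ pQ.
  by rewrite cardsT card_ord => En; rewrite -(eqn_pmul2r b_gt0) -En kbn.
suffices sub h : h \in <[g]> -> forall B, B \in Q -> 'P^*%act B h \in Q.
  apply/astabsP=> B; apply/idP/idP=> [gB|]; last exact/sub/cycle_id.
  by rewrite -(actK 'P^* g B) sub // groupV cycle_id.
move=> hg _ /imsetP[x _ ->]; apply/imsetP; exists (h x) => //.
have nh : h \in 'N(<[g ^+ k]>).
  apply: subsetP (cent_sub _) _ _; rewrite cent_cycle; apply/cent1P.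
  by case/cycleP: hg => j ->; apply: commuteX2.
have := setact_orbit 'P <[g ^+ k]> x h; rewrite (normP nh) !porbitE.
exact.
Qed.

End LongCycle.

Definition two_orbits n (A : {set 'I_n}) (y : 'S_n) :=
  forall x, porbit y x = if x \in A then A else ~: A.

Lemma porbit_pow_eq (T : finType) (s : {perm T}) y a b :
  (s ^+ a) y = (s ^+ b) y -> a = b %[mod #|porbit s y|].
Proof.
set c := #|_|; have c_gt0 : 0 < c by rewrite lt0n card_porbit_neq0.
have modE j : (s ^+ j) y = iter (j %% c) s y.
  rewrite {1}(divn_eq j c) addnC mulnC expgD expgM permM -permX.
  elim: (j %/ c) => [|q IHq]; first by rewrite expg0 perm1.
  rewrite expgSr permM IHq -permM -expgD addnC expgD permM.
  by rewrite [(s ^+ c) y]permX iter_porbit.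
rewrite !modE => /eqP.
have nthE j : j < c -> iter j s y = nth y (traject s y c) j by move=> lt; rewrite nth_traject.
rewrite !nthE ?ltn_mod // nth_uniq ?size_traject ?ltn_mod ?uniq_traject_porbit //.
by move/eqP.
Qed.

Section TwoOrbits.
Variable n : nat.
Implicit Types (A B : {set 'I_n}) (y s : 'S_n).

Lemma porbitJ y s x : porbit (y ^ s) (s x) = s @: porbit y x.
Proof.
apply/setP=> z; apply/porbitP/imsetP=> [[j ->]|[_ /porbitP[j ->] ->]].
  by exists ((y ^+ j) x); rewrite ?mem_porbit // -conjXg permJ.
by exists j; rewrite -conjXg permJ.
Qed.

Lemma two_orbitsJ A y s : two_orbits A y -> two_orbits (s @: A) (y ^ s).
Proof.
move=> tAy x; rewrite -[x](permKV s) porbitJ tAy mem_imset; last exact: perm_inj.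
case: ifP => // _; apply/setP=> z; rewrite inE -[z](permKV s) !mem_imset ?inE //; exact: perm_inj.
Qed.

Lemma fixed_set_closed B y x : y \in 'N(B | 'P) -> x \in B -> porbit y x \subset B.
Proof.
move=> yB Bx; apply/subsetP=> _ /porbitP[j ->].
by have := astabs_act x (groupX j yB); rewrite /= apermE Bx.
Qed.

Lemma two_orbits_fixed A B y : two_orbits A y -> y \in 'N(B | 'P) ->
  [\/ B = set0, B = A, B = ~: A | B = setT].
Proof.
move=> tAy yB; have := fixed_set_closed yB => sB.
have inA : A :&: B != set0 -> A \subset B.
  by case/set0Pn=> x /setIP[Ax Bx]; have := sB x Bx; rewrite tAy Ax.
have inC : ~: A :&: B != set0 -> ~: A \subset B.
  case/set0Pn=> x /setIP[]; rewrite inE => /negbTE Ax Bx.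
  by have := sB x Bx; rewrite tAy Ax.
have BE : B = (A :&: B) :|: (~: A :&: B) by rewrite -setIUl setUCr setTI.
have [A0|/inA sA] := eqVneq (A :&: B) set0; have [C0|/inC sC] := eqVneq (~: A :&: B) set0.
- by apply: Or41; rewrite BE A0 C0 setU0.
- by apply: Or43; rewrite BE A0 set0U; apply/setIidPl.
- by apply: Or42; rewrite BE C0 setU0; apply/setIidPl.
apply: Or44; apply/eqP; rewrite eqEsubset subsetT -(setUCr A) subUset sA.
exact: sC.
Qed.

(** A permutation fixing both halves would have A or its complement as a half. A
    permutation exchanging them would split each of its orbits evenly, but A has
    odd size. *)
Lemma two_orbits_no_halves A y h Q : (h + h)%N = n -> odd #|A| -> #|A| < h ->
  two_orbits A y -> Q \in equipartitions n 2 h -> y \notin 'N(Q | 'P^*).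
Proof.
move=> hn oA ltA tAy EQ; apply/negP=> yQ.
move: EQ; rewrite inE => /and3P[pQ cQ /forall_inP bQ].
have /cards2P[B [B' [BB' defQ]]] := cQ.
have QB : B \in Q by rewrite defQ set21.
have QB' : B' \in Q by rewrite defQ set22.
have cB : #|B| = h by apply/eqP/bQ.
have A_gt0 : 0 < #|A| by case: #|A| oA.
have cC : #|~: A| = (n - #|A|)%N by have := cardsC A; rewrite card_ord; lia.
have [yB|yB] := boolP (y \in 'N(B | 'P)).
  have [] := two_orbits_fixed tAy yB => eB; move: cB; rewrite eB ?cards0 ?cC ?cardsT ?card_ord; lia.
have disj : [disjoint B & B'] by apply: (trivIsetP (partition_trivIset pQ)).
have unB : B :|: B' = setT.
  have := cover_partition pQ; rewrite /cover defQ => <-.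
  by rewrite bigcup_setU !big_set1.
have actQ C : C \in Q -> 'P^*%act C y \in Q by move=> QC; rewrite (astabs_act C yQ).
have yBB' : 'P^*%act B y = B'.
  have := actQ B QB; rewrite [in X in X -> _]defQ => /set2P[eB|//].
  case/negP: yB; rewrite -astab1_set; exact/astab1P.
have yA x : (y x \in A) = (x \in A).
  have : y x \in porbit y x by have := mem_porbit y 1 x; rewrite expg1.
  by rewrite tAy; case: ifP => // Ax; rewrite inE => /negbTE.
have cAB : #|A :&: B'| = #|A :&: B|.
  rewrite -(card_imset (mem (A :&: B)) (@perm_inj _ y)); apply: eq_card => z.
  apply/setIP/imsetP=> [[Az]|[x /setIP[Ax Bx] ->]].
    rewrite -yBB' => /imsetP[x Bx def_z]; exists x => //.
    by rewrite inE Bx andbT -yA -[y x]def_z.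
  by rewrite yA Ax; split=> //; rewrite -yBB'; apply: (mem_setact 'P).
have : #|A| = (#|A :&: B| + #|A :&: B'|)%N.
  rewrite -cardsUI -setIUr unB setIT setIACA setIid.
  by move: disj; rewrite -setI_eq0 => /eqP->; rewrite setI0 cards0 addn0.
by move: oA => /[swap] ->; rewrite cAB addnn odd_double.
Qed.

Lemma turn_two_orbits A : two_orbits A (turn A).
Proof. exact: turn_orbit. Qed.

(** The parity of a permutation is that of the number of points plus the number
    of orbits. *)
Lemma turn_Alt A : ~~ odd n -> 0 < #|A| < n -> turn A \in 'Alt_('I_n).
Proof.
move=> en /andP[A0 An]; rewrite Alt_even /odd_perm card_ord (negbTE en) /=.
have -> : porbits (turn A) = [set A; ~: A].
  apply/setP=> B; apply/imsetP/set2P=> [[x _ ->]|].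
    by rewrite turn_orbit; case: ifP; [left | right].
  have [x Ax] := card_gt0P A0.
  have : 0 < #|~: A| by have := cardsC A; rewrite card_ord; lia.
  case/card_gt0P=> z; rewrite inE => /negbTE nAz [] ->.
    by exists x; rewrite // turn_orbit Ax.
  by exists z; rewrite // turn_orbit nAz.
have [x Ax] := card_gt0P A0.
have AC : A != ~: A by apply/eqP=> /setP/(_ x); rewrite inE Ax.
by rewrite cards2 AC.
Qed.

Lemma turn_long : porbit (turn [set: 'I_n]) =1 fun _ => setT.
Proof. by move=> x; rewrite turn_orbit inE. Qed.

Lemma turnT_Alt : odd n -> turn [set: 'I_n] \in 'Alt_('I_n).
Proof.
move=> on; rewrite Alt_even /odd_perm card_ord on /=.
have -> : porbits (turn [set: 'I_n]) = [set setT].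
  apply/setP=> B; rewrite inE; apply/imsetP/eqP=> [[x _ ->]|->].
    by rewrite turn_long.
  have n0 : 0 < n by case: (n) on.
  by exists (Ordinal n0); rewrite // turn_long.
by rewrite cards1.
Qed.

(** If s has an orbit of odd size, it or its complement has size at most h, and
    size h gives an invariant partition into two halves. If all the orbits are
    even, colour the points alternately along each of them: s exchanges the two
    colours. *)
Lemma odd_set_or_halves h s : (h + h)%N = n -> 0 < h ->
  (exists B, [/\ odd #|B|, #|B| < h & s \in 'N(B | 'P)]) \/
  (exists2 Q, Q \in equipartitions n 2 h & s \in 'N(Q | 'P^*)).
Proof.
move=> hn h0.
have halves B : #|B| = h -> s @: B = B \/ s @: B = ~: B ->
    exists2 Q, Q \in equipartitions n 2 h & s \in 'N(Q | 'P^*).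
  move=> cB sB; have cC : #|~: B| = h by have := cardsC B; rewrite card_ord; lia.
  have [x Bx] : exists x, x \in B by apply/card_gt0P; rewrite cB.
  have [z Cz] : exists z, z \in ~: B by apply/card_gt0P; rewrite cC.
  have BC : B != ~: B by apply/eqP=> /setP/(_ x); rewrite inE Bx.
  exists [set B; ~: B].
    rewrite inE cards2 BC /=; apply/andP; split; last first.
      by apply/forall_inP=> C /set2P[]->; rewrite ?cB ?cC.
    apply/and3P; split.
    - by rewrite /cover bigcup_setU !big_set1 setUCr.
    - apply/trivIsetP=> C D /set2P[]-> /set2P[]->; rewrite ?eqxx // -setI_eq0 ?setICr //.
      by rewrite setIC setICr.
    - rewrite !inE negb_or; apply/andP; split; apply/eqP=> e0.
        by rewrite -e0 inE in Bx.
      by rewrite -e0 inE in Cz.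
  have imC : s @: (~: B) = ~: (s @: B).
    apply/setP=> w; rewrite inE -[w](permKV s) !mem_imset ?inE //; exact: perm_inj.
  rewrite inE; apply/andP; split; first by rewrite inE.
  rewrite inE; apply/subsetP=> C; rewrite !inE.
  have aE (D : {set 'I_n}) : 'P^*%act D s = s @: D by [].
  by case/orP=> /eqP->; rewrite aE ?imC; case: sB => ->; rewrite ?setCK eqxx ?orbT.
have imP x : s @: porbit s x = porbit s x.
  have := porbitJ s s x; rewrite conjgE mulKg => <-.
  by have := porbit_perm s 1 x; rewrite expg1.
have imN (B : {set 'I_n}) : s @: B = B -> s \in 'N(B | 'P).
  by move=> sB; rewrite -astab1_set; apply/astab1P.
have [/existsP[x ox]|] := boolP [exists x, odd #|porbit s x|].
  have := cardsC (porbit s x); rewrite card_ord => cC.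
  have [lt|gt|eq] := ltngtP #|porbit s x| h.
  - by left; exists (porbit s x); rewrite imN.
  - left; exists (~: porbit s x); split; [by lia | by lia |].
    by rewrite astabsC imN.
  by right; apply: (halves (porbit s x)); rewrite ?imP; last left.
rewrite negb_exists => /forallP ev; right.
(* B collects the points at even distance from a base point of their orbit. *)
pose r (X : {set 'I_n}) : option 'I_n := [pick x in X].
pose B := [set x | if r (porbit s x) is Some y then x \in porbit (s ^+ 2) y else false].
have rP x : exists2 y, r (porbit s x) = Some y & y \in porbit s x.
  rewrite /r; case: pickP => [y xy|/(_ x)]; first by exists y.
  by rewrite porbit_id.
have porS x : porbit s (s x) = porbit s x by have := porbit_perm s 1 x; rewrite expg1.
have parity (x y : 'I_n) j : x = (s ^+ j) y -> (x \in porbit (s ^+ 2) y) = ~~ odd j.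
  move=> ->; apply/porbitP/idP=> [[k]|ej].
    rewrite -expgM => E; have cy := ev y.
    have := porbit_pow_eq E; move: (negbTE (ev y)); set c := #|_| => oc /(congr1 odd).
    by rewrite !odd_mod // oddM => ->.
  by exists j./2; rewrite -expgM mul2n even_halfK.
have sB x : (s x \in B) = (x \notin B).
  rewrite !inE porS; have [y -> xy] := rP x.
  have /porbitP[j xj] : x \in porbit s y by rewrite porbit_sym.
  by rewrite (parity x y j) // (parity (s x) y j.+1) ?negbK //= xj expgSr permM.
have imB : s @: B = ~: B.
  apply/setP=> w; rewrite inE -[w](permKV s) sB negbK mem_imset //; exact: perm_inj.
apply: (halves B); last by right.
have := cardsC B; rewrite -imB (card_imset _ (@perm_inj _ s)) card_ord; lia.
Qed.

End TwoOrbits.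

(** * Covering the alternating group by point stabilizers *)

Lemma sum_setU_le (T : finType) (A B : {set T}) (w : T -> nat) :
  (\sum_(x in A :|: B) w x <= \sum_(x in A) w x + \sum_(x in B) w x)%N.
Proof.
rewrite [X in X <= _]big_mkcond [X in _ <= X + _]big_mkcond [X in _ <= _ + X]big_mkcond.
rewrite -big_split /=.
by apply: leq_sum => x _; rewrite inE; case: (x \in A) => /=; rewrite ?leq_addr.
Qed.

Lemma sum_bigcup_le (K T : finType) (F : K -> {set T}) (w : T -> nat) :
  (\sum_(x in \bigcup_k F k) w x <= \sum_k \sum_(x in F k) w x)%N.
Proof.
apply: (big_rec2 (fun (A : {set T}) y => \sum_(x in A) w x <= y)%N) => [|k A y _ leA].
  by rewrite big_set0.
by apply: leq_trans (sum_setU_le _ _ _) _; rewrite leq_add2l.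
Qed.

Lemma sum_imset_le (K T : finType) (D : {set K}) (F : K -> T) (w : T -> nat) :
  (\sum_(x in F @: D) w x <= \sum_(k in D) w (F k))%N.
Proof.
rewrite (partition_big F (mem (F @: D))) /=; last by move=> k Dk; apply: imset_f.
apply: leq_sum => _ /imsetP[k Dk ->].
by rewrite (bigD1 k) /= ?Dk ?eqxx // leq_addr.
Qed.

Section PointStabilizers.
Variables (n m : nat).
Hypothesis m_gt0 : 0 < m.
Local Notation A_n := 'Alt_('I_n).

(** Each of the |O| stabilizers has index at most |O|. *)
Lemma sum_index_stab (rT : finType) (to : {action 'S_n &-> rT}) (O : {set rT}) :
    (forall s x, x \in O -> to x s \in O) ->
  (\sum_(x in O) #|A_n : 'C_A_n[x | to]| ^ m.-1 <= #|O| ^ m)%N.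
Proof.
move=> stO; rewrite -{2}(prednK m_gt0) expnS -sum_nat_const; apply: leq_sum => x Ox.
rewrite -card_orbit leq_expr // subset_leq_card //.
by apply/subsetP=> _ /imsetP[s _ ->]; apply: stO.
Qed.

Lemma setact_subsets_of i (s : 'S_n) A : A \in subsets_of n i -> 'P^*%act A s \in subsets_of n i.
Proof. by rewrite !inE card_setact. Qed.

Lemma stab_proper (rT : finType) (to : {action 'S_n &-> rT}) (O : {set rT}) x :
    [transitive A_n, on O | to] -> x \in O -> 1 < #|O| -> 'C_A_n[x | to] \proper A_n.
Proof.
move=> trO Ox O1; rewrite properEneq subsetIl andbT; apply: contraTneq O1 => eA.
by rewrite -(atransP trO x Ox) card_orbit eA indexgg.
Qed.

Lemma Alt_primitive : 4 < n -> [primitive A_n, on setT | 'P].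
Proof.
move=> n4; apply: (@ntransitive_primitive _ _ _ _ _ #|'I_n|.-2); first by rewrite card_ord; lia.
exact: Alt_trans.
Qed.

(** The alternating group preserves no such partition, since it is primitive. *)
Lemma equipartition_stab_proper k b Q : 4 < n -> 1 < k -> 1 < b -> Q \in equipartitions n k b ->
  'C_A_n[Q | 'P^*^*] \proper A_n.
Proof.
move=> n4 k1 b1 EQ; rewrite properEneq subsetIl andbT; apply/eqP=> eA.
have /andP[_ /negP[]] := Alt_primitive n4; apply/existsP; exists Q.
have kbn := equipartition_size EQ; move: EQ; rewrite inE => /and3P[pQ /eqP cQ _].
have ltk : k < n by rewrite -kbn ltn_Pmulr // (ltn_trans _ k1).
rewrite /imprimitivity_system pQ cQ k1 cardsT card_ord ltk /= andbT.
by rewrite -astab1_set; apply/setIidPl.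
Qed.

Variables (K : finType) (f : K -> nat) (k b : nat).
Hypotheses (n4 : 4 < n) (k1 : 1 < k) (b1 : 1 < b).
Hypothesis f_bound : forall i, 0 < f i < n.

(** Cover by the stabilizers, one for each subset of a size f i and one for each
    partition; the index of a stabilizer is at most the number of objects of its
    kind, hence the exponent m in place of m - 1. *)
Lemma u_le_subsets_equipartitions :
    (forall s, s \in A_n ->
       (exists2 B : {set 'I_n}, s \in 'N(B | 'P) & exists i, #|B| = f i) \/
       (exists2 Q, s \in 'N(Q | 'P^*) & Q \in equipartitions n k b)) ->
  (exists N, is_covering A_n N) /\
  (u m n <= alpha m + (\sum_i 'C(n, f i) ^ m + #|equipartitions n k b| ^ m))%N.
Proof.
move=> cov.
pose O1 := \bigcup_i subsets_of n (f i).
pose F1 (B : {set 'I_n}) := ('C_A_n[B | 'P^*])%G.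
pose F2 (Q : {set {set 'I_n}}) := ('C_A_n[Q | 'P^*^*])%G.
pose N := (F1 @: O1) :|: (F2 @: equipartitions n k b).
have covN : is_covering A_n N.
  apply/andP; split.
    apply/forall_inP=> M /setUP[] /imsetP[x Ox ->]; last exact: equipartition_stab_proper Ox.
    have [i _ xi] := bigcupP Ox; have /andP[f0 fn] := f_bound i.
    apply: (stab_proper (O := subsets_of n (f i))) => //.
      by apply: Alt_trans_subsets; [apply: ltn_trans n4 | apply: ltnW].
    rewrite card_subsets_of; case: (n) (f i) f0 fn => // n' [] // j _ lt_j.
    have c1 : 0 < 'C(n', j.+1) by rewrite bin_gt0.
    have c2 : 0 < 'C(n', j) by rewrite bin_gt0 ltnW.
    by rewrite binS; lia.
  rewrite eqEsubset; apply/andP; split.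
    by apply/bigcupsP=> M /setUP[] /imsetP[x Ox ->]; apply: subsetIl.
  apply/subsetP=> s As; apply/bigcupP.
  case: (cov s As) => [[B sB [i cB]]|[Q sQ EQ]].
    exists (F1 B); last by rewrite inE As /= astab1_set.
    by apply/setUP; left; apply: imset_f; apply/bigcupP; exists i; rewrite ?inE ?cB.
  exists (F2 Q); last by rewrite inE As /= astab1_set.
  by apply/setUP; right; apply: imset_f.
split; first by exists N.
rewrite leq_add2l; apply: leq_trans (min_covering_le _ covN) _.
apply: leq_trans (sum_setU_le _ _ _) _; apply: leq_add; apply: leq_trans (sum_imset_le _ _ _) _.
  apply: leq_trans (sum_bigcup_le _ _) _; apply: leq_sum => i _.
  rewrite -card_subsets_of; apply: sum_index_stab => s x; exact: setact_subsets_of.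
by apply: sum_index_stab => s x; apply: setact_equipartitions.
Qed.

End PointStabilizers.

(** * Bounds for a fixed degree *)

Lemma sigma_le_u m n : 0 < m -> (exists N, is_covering 'Alt_('I_n) N) ->
  (~~ cyclic [set: alt_wreath n m]) /\ (sigma [set: alt_wreath n m]%G <= u m n)%N.
Proof.
move=> m_gt0 [N0 covN0].
have [N covN eqN] := min_coveringP
  (fun N => \sum_(M in N) #|'Alt_('I_n) : M| ^ m.-1)%N (covering_not_cyclic covN0).
have [ncW leN] := sigma_wreath_le m_gt0 covN.
by split=> //; rewrite /u eqN.
Qed.

Lemma imprimitive_equipartition n (T : {group 'S_n}) Q : 0 < n ->
    [transitive T, on setT | 'P] -> imprimitivity_system T setT 'P Q ->
  exists k b, [/\ Q \in equipartitions n k b, 1 < k, 1 < b & T \subset 'N(Q | 'P^*)].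
Proof.
move=> n_gt0 trT /and3P[pQ actT /andP[Q1 Qn]].
have tiQ := partition_trivIset pQ; have covQ := cover_partition pQ.
have [B QB] : exists B, B \in Q by apply/card_gt0P/ltnW.
have bQ C : C \in Q -> #|C| = #|B|.
  move=> QC; have [x Bx] := set0Pn _ (partition_neq0 pQ QB).
  have [y Cy] := set0Pn _ (partition_neq0 pQ QC).
  have [t Tt def_y] := atransP2 trT (in_setT x) (in_setT y).
  rewrite -(card_setact 'P B t); congr #|pred_of_set _|.
  have tQ : 'P^*%act B t \in Q by rewrite (acts_act actT).
  rewrite -(def_pblock tiQ QC Cy); apply: def_pblock => //.
  by rewrite def_y; apply: (mem_setact 'P).
exists #|Q|, #|B|; have EQ : Q \in equipartitions n #|Q| #|B|.
  by rewrite inE pQ eqxx; apply/forall_inP=> C /bQ->.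
split=> //; have := equipartition_size EQ; move: Qn; rewrite cardsT card_ord; nia.
Qed.

Lemma card_Alt_half n a : 1 < n -> (2 * a <= n`! -> a <= #|'Alt_('I_n)|)%N.
Proof. by move=> n1; rewrite -{1}[n]card_ord -card_Alt ?card_ord // leq_pmul2l. Qed.

(** In the first alternative T is small enough to be harmless: by Bochert's
    theorem if T is primitive, and by counting the permutations that preserve a
    partition if T is imprimitive with more than p blocks. *)
Lemma transitive_dichotomy n p P D (T : {group 'S_n}) :
    4 < n -> T \proper 'Alt_('I_n) -> [transitive T, on setT | 'P] ->
    (2 * (P * D) <= (uphalf n)`!)%N ->
    (forall k b, p < k -> 1 < b -> (k * b)%N = n ->
       (2 * (b`! ^ k * k`! * (P * D)) <= n`!)%N) ->
  (#|T| * P * D <= #|'Alt_('I_n)|)%N \/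
  exists Q k b, [/\ Q \in equipartitions n k b, 1 < k <= p, 1 < b & T \subset 'N(Q | 'P^*)].
Proof.
move=> n4 prT trT bochert imprim; have n1 : 1 < n by apply: ltn_trans n4.
have n0 : 0 < n by apply: ltn_trans n1.
have [prim|] := boolP [primitive T, on setT | 'P].
  left; apply: card_Alt_half => //.
  have nAT : ~~ ('Alt_('I_n) \subset T).
    by case/properP: prT => _ [s As nTs]; apply/subsetPn; exists s.
  have := Bochert prim nAT; rewrite card_ord; apply: leq_trans.
  by rewrite -mulnA mulnCA leq_mul2l bochert orbT.
rewrite /primitive trT /= negbK => /existsP[Q /(imprimitive_equipartition n0 trT)].
move=> [k [b [EQ k1 b1 actT]]]; have [le_kp|lt_pk] := leqP k p.
  by right; exists Q, k, b; rewrite k1.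
left; apply: card_Alt_half => //; apply: leq_trans (imprim k b lt_pk b1 (equipartition_size EQ)).
by rewrite -mulnA !leq_mul2l leq_mul2r (card_acts_equipartition EQ actT) orbT.
Qed.

Lemma orbit_setT_trans n (T : {group 'S_n}) x :
  orbit 'P T x = setT -> [transitive T, on setT | 'P].
Proof. by move=> oT; apply/imsetP; exists x. Qed.

Section Bounds.
Variables (m n p : nat).
Local Notation A_n := 'Alt_('I_n).
Local Notation D := (n ^ 3)%N.
Local Notation P := (p ^ n)%N.
Hypotheses (m_gt0 : 0 < m) (n4 : 4 < n).
Hypothesis bochert : (2 * (P * D) <= (uphalf n)`!)%N.
Hypothesis imprim : forall k b, p < k -> 1 < b -> (k * b)%N = n ->
  (2 * (b`! ^ k * k`! * (P * D)) <= n`!)%N.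
Hypothesis diag : (2 * (P ^ 2 * D ^ 2) <= n`!)%N.

Let n1 : 1 < n. Proof. exact: ltn_trans n4. Qed.
Let simA : simple A_n. Proof. by apply: simple_Alt5; rewrite card_ord. Qed.
Let nabA : ~~ abelian A_n.
Proof.
by apply/negP=> /abelian_sol; rewrite solvable_AltF ?card_ord.
Qed.
Let diagA : (P ^ 2 * D ^ 2 <= #|A_n|)%N.
Proof. exact: card_Alt_half. Qed.

(** The weights are put on the class of an n-cycle, an even permutation as n is
    odd. An n-cycle fixes just one partition into p blocks of size b; it lies in
    no intransitive subgroup, and p is the least possible number of blocks of an
    imprimitive one. Conversely a permutation that is not an n-cycle has an
    invariant subset. The last inequality says that there are many such
    partitions. *)
Lemma odd_degree_bounds b : odd n -> p = pdiv n -> (p * b)%N = n -> 1 < b ->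
  let N := #|equipartitions n p b| in
  [/\ N ^ m <= sigma [set: alt_wreath n m]%G, sigma [set: alt_wreath n m]%G <= u m n,
      u m n <= alpha m + (\sum_(i < n.-1) 'C(n, i.+1) ^ m + N ^ m)
    & n`! <= 2 * (b`! ^ p * p`! * N)]%N.
Proof.
move=> on def_p pbn b1 N; pose g := turn [set: 'I_n].
have Ag : g \in A_n by apply: turnT_Alt.
have gE x : porbit g x = setT by apply: turn_long.
have gJ a x : porbit (g ^ a) x = setT.
  rewrite -[x](permKV a) porbitJ gE; apply/setP=> z; rewrite inE -[z](permKV a) mem_imset ?inE //.
  exact: perm_inj.
have n0 : 0 < n by apply: ltn_trans n1.
have pr_p : prime p by rewrite def_p pdiv_prime.
have p1 := prime_gt1 pr_p.
have [EQg _] := long_cycle_porbits gE pbn n0.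
have trE : [transitive A_n, on equipartitions n p b | 'P^*^*].
  exact: Alt_trans_equipartitions (ltnW p1) b1 EQg.
have cover s : s \in A_n ->
    (exists2 B : {set 'I_n}, s \in 'N(B | 'P) & exists i : 'I_n.-1, #|B| = i.+1) \/
    (exists2 Q, s \in 'N(Q | 'P^*) & Q \in equipartitions n p b).
  move=> As; have [/forallP sE|] := boolP [forall x, porbit s x == setT].
    right; have sE' x : porbit s x = setT by apply/eqP.
    by have [EQ sQ] := long_cycle_porbits sE' pbn n0; exists (porbits (s ^+ p)).
  rewrite negb_forall => /existsP[x sx]; left; exists (porbit s x).
    rewrite -astab1_set; apply/astab1P.
    have := porbitJ s s x; rewrite conjgE mulKg => E; rewrite [LHS](esym E).
    by have := porbit_perm s 1 x; rewrite expg1.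
  have lt : #|porbit s x| < n.
    have := subset_leq_card (subsetT (porbit s x)); rewrite cardsT card_ord leq_eqVlt.
    case/orP=> // /eqP c; case/negP: sx; apply/eqP/setP/subset_cardP; last exact: subsetT.
    by rewrite c cardsT card_ord.
  have gt : 0 < #|porbit s x| by rewrite lt0n card_porbit_neq0.
  have lt' : #|porbit s x|.-1 < n.-1 by rewrite -ltnS !prednK.
  by exists (Ordinal lt'); rewrite /= prednK.
have f_bound (i : 'I_n.-1) : 0 < i.+1 < n by have := ltn_ord i; rewrite -ltnS prednK.
have [covN leu] := u_le_subsets_equipartitions m_gt0 n4 p1 b1 f_bound cover.
have [ncW lesig] := sigma_le_u m_gt0 covN.
split=> //.
- have -> : (N ^ m = \sum_(i < 1) N ^ m)%N by rewrite big_ord1.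
  apply: (@classes_le_sigma _ _ _ _ (fun _ : 'I_1 => g) (fun _ => N) P (n ^ 2) D) => //.
  + move=> _; apply: leq_trans (subset_leq_card (subsetIr _ _)) _.
    rewrite (leq_trans (card_cent_orbits (t := [tuple Ordinal n0]) _)) //.
      by move=> x; exists ord0; rewrite gE inE.
    by rewrite card_ord leq_pexp2l.
  + by rewrite card_ord mul1n leq_pexp2l.
  + by move=> _; apply: card_equipartitions_le.
  move=> T prT; have [T0|] := eqVneq (T :&: g ^: A_n) set0.
    by left; exists ord0 => i.
  case/set0Pn=> y /setIP[Ty /imsetP[a Aa def_y]]; rewrite def_y in Ty.
  have trT : [transitive T, on setT | 'P].
    apply: (@orbit_setT_trans _ _ (Ordinal n0)); apply/eqP; rewrite eqEsubset subsetT.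
    rewrite -(gJ a (Ordinal n0)) porbitE; apply: imsetS; by rewrite cycle_subG.
  have [bT|[Q [k [b' [EQ /andP[k1 kp] b'1 actT]]]]] :=
    transitive_dichotomy n4 prT trT bochert imprim; first by right.
  have kbn := equipartition_size EQ.
  have ekp : k = p.
    apply/eqP; rewrite eqn_leq kp {1}def_p pdiv_min_dvd //.
    by rewrite -kbn dvdn_mulr.
  have eb : b' = b.
    by apply/eqP; rewrite -(eqn_pmul2l (ltnW k1)) kbn ekp pbn.
  rewrite ekp eb in EQ; left; exists ord0 => i _; split; first by rewrite ord1.
    apply: (stab_index_bound trE EQ); rewrite subsetI (proper_sub prT).
    by rewrite astab1_set.
  apply: (stab_class_bound trE EQ); first by rewrite subsetI (proper_sub prT) astab1_set.
  move=> z Q1 Q2 /imsetP[a' _ ->] EQ1 EQ2; rewrite !astab1_set => y1 y2.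
  by rewrite (long_cycle_equipartition (gJ a') EQ1 y1) (long_cycle_equipartition (gJ a') EQ2 y2).
rewrite -{1}[n]card_ord -card_Alt ?card_ord // leq_pmul2l //.
rewrite -(card_orbit_stab 'P^*^* A_n (porbits (g ^+ p))) (atransP trE) // mulnC leq_mul2r.
apply/orP; right; apply: (card_acts_equipartition (T := ('C_A_n[porbits (g ^+ p) | 'P^*^*])%G) EQg).
by rewrite -astab1_set subsetIr.
Qed.

Lemma bin_le_exp2 i : 'C(n, i) <= 2 ^ n.
Proof.
apply: (@leq_trans #|powerset [set: 'I_n]|); last first.
  by rewrite card_powerset cardsT card_ord.
rewrite -card_subsets_of subset_leq_card //.
by apply/subsetP=> A _; rewrite powersetE subsetT.
Qed.

(** A partition into two halves is determined by one of them. *)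
Lemma card_halves_le h : (h + h)%N = n -> #|equipartitions n 2 h| <= 'C(n, h).
Proof.
move=> hn; pose F (B : {set 'I_n}) := [set B; ~: B].
rewrite -card_subsets_of; apply: leq_trans (leq_imset_card F _); apply: subset_leq_card.
apply/subsetP=> Q; rewrite inE => /and3P[pQ cQ /forall_inP bQ].
have /cards2P[B [B' [BB' defQ]]] := cQ.
have QB : B \in Q by rewrite defQ set21.
have QB' : B' \in Q by rewrite defQ set22.
apply/imsetP; exists B; first by rewrite inE bQ.
rewrite /F defQ; congr [set _; _]; apply/setP=> x; rewrite inE.
have := cover_partition pQ; rewrite /cover defQ bigcup_setU !big_set1 => /setP/(_ x).
have /pred0P/(_ x) := trivIsetP (partition_trivIset pQ) B B' QB QB' BB'.
by rewrite !inE /=; case: (x \in B); case: (x \in B').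
Qed.

(** The weights are put on the permutations with two orbits, of sizes i and n - i
    with i < h odd: these are even permutations as n is even, and each of them
    fixes just one i-subset. They preserve no partition into two halves, and the
    stabilizer of a subset meets at most one of their classes. The covering
    consists of the stabilizers of the i-subsets, which have the right number,
    and of the partitions into two halves, whose contribution is negligible. *)
Lemma even_degree_bounds h : (h + h)%N = n -> p = 2 ->
  let L := \sum_(j < h./2) 'C(n, j.*2.+1) ^ m in
  [/\ L <= sigma [set: alt_wreath n m]%G, sigma [set: alt_wreath n m]%G <= u m n
    & u m n <= alpha m + (L + 'C(n, h) ^ m)]%N.
Proof.
move=> hn p2 L; have n0 : 0 < n by apply: ltn_trans n1.
have en : ~~ odd n by rewrite -hn addnn odd_double.
have h1 : 1 < h by lia.
have ltf (j : 'I_h./2) : j.*2.+1 < h.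
  by have := ltn_ord j; have := odd_double_half h; lia.
have f_bound (j : 'I_h./2) : 0 < j.*2.+1 < n by have := ltf j; lia.
have cover s : s \in A_n ->
    (exists2 B : {set 'I_n}, s \in 'N(B | 'P) & exists j : 'I_h./2, #|B| = j.*2.+1) \/
    (exists2 Q, s \in 'N(Q | 'P^*) & Q \in equipartitions n 2 h).
  move=> _; have [[B [oB ltB sB]]|[Q EQ sQ]] := odd_set_or_halves s hn (ltnW h1); last first.
    by right; exists Q.
  left; exists B => //; have lt : #|B|./2 < h./2.
    by have := odd_double_half #|B|; have := odd_double_half h; rewrite oB; lia.
  by exists (Ordinal lt); have /= := odd_double_half #|B|; rewrite oB; lia.
have [covN leu] := u_le_subsets_equipartitions m_gt0 n4 (isT : 1 < 2) h1 f_bound cover.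
have [ncW lesig] := sigma_le_u m_gt0 covN.
split=> //; last first.
  by apply: leq_trans leu _; rewrite !leq_add2l leq_expr // card_halves_le.
have /fin_all_exists[A cA] (j : 'I_h./2) : exists A : {set 'I_n}, #|A| = j.*2.+1.
  have : 0 < #|subsets_of n j.*2.+1|.
    by rewrite card_subsets_of bin_gt0; have /andP[_ /ltnW] := f_bound j.
  by case/card_gt0P=> A; rewrite inE => /eqP; exists A.
pose g j := turn (A j).
have Ag j : g j \in A_n by apply: turn_Alt; rewrite ?cA.
have gJ j (a : 'S_n) : two_orbits (a @: A j) (g j ^ a) by apply/two_orbitsJ/turn_two_orbits.
have cAJ j (a : 'S_n) : #|a @: A j| = j.*2.+1 by rewrite card_imset ?cA //; apply: perm_inj.
have cC (B : {set 'I_n}) : #|~: B| = (n - #|B|)%N by have := cardsC B; rewrite card_ord; lia.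
have trS (j : 'I_h./2) : [transitive A_n, on subsets_of n j.*2.+1 | 'P^*].
  apply: Alt_trans_subsets; first exact: ltn_trans n4.
  by have /andP[_ /ltnW] := f_bound j.
have half x : x < h -> ~~ (n - x < h).
  by move=> /ltnW lex; rewrite -leqNgt -hn -addnBA // leq_addr.
have h2 : 0 < h./2 by lia.
apply: (@classes_le_sigma _ _ _ _ g (fun j => 'C(n, j.*2.+1)) P (n ^ 2) D) => //.
- move=> j; apply: leq_trans (subset_leq_card (subsetIr _ _)) _.
  have [x Ax] : exists x, x \in A j by apply/card_gt0P; rewrite cA.
  have [z Cz] : exists z, z \in ~: A j.
    by apply/card_gt0P; rewrite cC cA subn_gt0; have /andP[] := f_bound j.
  rewrite (leq_trans (card_cent_orbits (t := [tuple x; z]) _)) ?card_ord //.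
  move=> w; have [Aw|nAw] := boolP (w \in A j).
    by exists ord0; rewrite turn_two_orbits (tnth_nth x) /= Ax.
  exists (lift ord0 ord0); rewrite turn_two_orbits (tnth_nth x) /=.
  by move: Cz; rewrite inE => /negbTE->; rewrite inE.
- rewrite card_ord [X in _ <= X]expnS leq_mul2r; apply/orP; right; lia.
- by move=> j; rewrite p2 bin_le_exp2.
move=> T prT.
have [trT|ntrT] := boolP [transitive T, on setT | 'P].
  have [bT|[Q [k [b' [EQ /andP[k1 kp] b'1 actT]]]]] :=
    transitive_dichotomy n4 prT trT bochert imprim; first by right.
  have ek : k = 2 by move: k1 kp; rewrite p2; case: (k) => [|[|[]]].
  have eb : b' = h.
    have := equipartition_size EQ; rewrite ek -hn addnn -mul2n => /eqP.
    by rewrite eqn_pmul2l // => /eqP.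
  rewrite ek eb in EQ; left; exists (Ordinal h2) => j.
  case/set0Pn=> y /setIP[Ty /imsetP[a _ def_y]]; rewrite {y}def_y in Ty.
  have := two_orbits_no_halves hn _ _ (gJ j a) EQ; rewrite cAJ.
  by rewrite (subsetP actT _ Ty) /= odd_double => /(_ isT (ltf j)).
have [B [B0 BT TB]] : exists B : {set 'I_n}, [/\ B != set0, B != setT & T \subset 'N(B | 'P)].
  exists (orbit 'P T (Ordinal n0)); split.
  - by apply/set0Pn; exists (Ordinal n0); apply: orbit_refl.
  - by apply: contra ntrT => /eqP; apply: orbit_setT_trans.
  by apply: acts_orbit; apply: subsetT.
have meetB j : T :&: g j ^: A_n != set0 -> exists2 B' : {set 'I_n},
    #|B'| = j.*2.+1 & T \subset 'N(B' | 'P) /\ (B' = B \/ B' = ~: B).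
  case/set0Pn=> y /setIP[Ty /imsetP[a _ def_y]]; rewrite {y}def_y in Ty.
  have [] := two_orbits_fixed (gJ j a) (subsetP TB _ Ty) => eB.
  - by rewrite eB eqxx in B0.
  - by exists B; [rewrite eB cAJ | split; [|left]].
  - by exists (~: B); [rewrite eB setCK cAJ | split; [rewrite astabsC|right]].
  by rewrite eB eqxx in BT.
left.
have [[i0 Ti0]|none] : (exists i0, T :&: g i0 ^: A_n != set0) \/ (forall j, T :&: g j ^: A_n == set0).
- have [/existsP[i0 ?]|] := boolP [exists i0, T :&: g i0 ^: A_n != set0]; first by left; exists i0.
  by rewrite negb_exists => /forallP no; right=> j; have := no j; rewrite negbK.
- exists i0 => j Tj; have [B1 c1 [T1 e1]] := meetB i0 Ti0.
  have [B2 c2 [T2 e2]] := meetB j Tj.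
  have ej : j.*2.+1 = i0.*2.+1.
    have ltj := ltf j; have lti := ltf i0; rewrite -c1 -c2 in ltj lti *.
    have cCB (X : {set 'I_n}) : #|X| < h -> ~~ (#|~: X| < h) by rewrite cC; apply: half.
    by case: e1 e2 ltj lti => -> [] -> // ltj lti; have := cCB B; rewrite ltj lti => /(_ isT).
  have OB2 : B2 \in subsets_of n j.*2.+1 by rewrite inE c2.
  have sT2 : T \subset 'C_A_n[B2 | 'P^*] by rewrite subsetI (proper_sub prT) astab1_set.
  rewrite -card_subsets_of; split.
  + by apply: val_inj; apply: double_inj; case: ej.
  + exact: (stab_index_bound (trS j) OB2).
  apply: (stab_class_bound (trS j) OB2) => // y Q1 Q2 /imsetP[a _ ->] SQ1 SQ2.
  rewrite !astab1_set => y1 y2.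
  have only (R : {set 'I_n}) : R \in subsets_of n j.*2.+1 ->
      g j ^ a \in 'N(R | 'P) -> R = a @: A j.
    have ltj := ltf j; have /andP[_ ltjn] := f_bound j.
    rewrite inE => /eqP cR /(two_orbits_fixed (gJ j a)) []// eR; move: cR; rewrite eR.
    - by rewrite cards0.
    - by rewrite cC cAJ => ej'; have := half _ ltj; rewrite ej' ltj.
    - by rewrite cardsT card_ord => en'; move: ltjn; rewrite -{1}en' ltnn.
  exact: etrans (only Q1 SQ1 y1) (esym (only Q2 SQ2 y2)).
by exists (Ordinal h2) => j; rewrite (eqP (none j)) eqxx.
Qed.

End Bounds.

Local Close Scope group_scope.

(** * Sums of binomial coefficients near the middle *)

(** The ratio of the binomial coefficients at h - d and h is the product of the
    (h - t + 1) / (h + t) for 1 <= t <= d, hence at least 1 - d^2 / h. *)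
Lemma bin_near_middle h d : d ^ 2 <= h ->
  'C(h + h, h) * (h - d ^ 2) <= h * 'C(h + h, h - d).
Proof.
elim: d => [|d IHd] dh; first by rewrite exp0n // !subn0 mulnC.
have dh' : d ^ 2 <= h by apply: leq_trans dh; rewrite leq_exp2r.
have ltdh : d < h by apply: leq_trans dh; rewrite expnS expn1; nia.
have E : (h + d).+1 * 'C(h + h, h - d.+1) = (h - d) * 'C(h + h, h - d).
  have := mul_bin_left (h + h) (h - d.+1).
  by rewrite -subSn // subSS => ->; congr (_ * _); lia.
have {IHd} := IHd dh'; set x := 'C(_, h - d) in E *; set y := 'C(_, h - d.+1) in E *.
set c := 'C(_, _); move=> IHd.
have hd : 0 < (h + d).+1 by [].
rewrite -(leq_pmul2l hd) [X in _ <= X]mulnCA E [X in _ <= X]mulnCA.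
apply: (@leq_trans ((h - d) * (c * (h - d ^ 2)))); last by rewrite leq_mul2l IHd orbT.
rewrite mulnCA [X in _ <= X]mulnCA leq_mul2l; apply/orP; right.
by move: dh dh' ltdh; rewrite !expnS !expn0 !muln1; nia.
Qed.

Lemma alpha_le m : 0 < m -> alpha m <= m.
Proof.
move=> m_gt0; rewrite /alpha -[X in _ <= X](size_iota 1).
apply: uniq_leq_size; first exact: primes_uniq.
move=> q; rewrite mem_primes mem_iota => /and3P[pq _ qm].
by rewrite prime_gt0 //= add1n ltnS dvdn_leq.
Qed.

(** For h large, any fixed number of the binomial coefficients at the odd indices
    just below h are at least half the central one. *)
Lemma odd_bin_sum_large m J : exists h0, forall h, h0 <= h ->
  J * 'C(h + h, h) ^ m <= \sum_(j < h./2) 'C(h + h, j.*2.+1) ^ m.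
Proof.
(* The J' largest odd indices below h are at distance at most 2 J' from h. *)
pose J' := J * 2 ^ m; exists (2 * (J'.*2) ^ 2 + J'.*2.+4) => h le_h.
set c := 'C(h + h, h).
have hJ : J' <= h./2 by have := odd_double_half h; lia.
have term s : s < J' -> c ^ m <= 2 ^ m * 'C(h + h, (h./2 - s.+1).*2.+1) ^ m.
  move=> sJ; rewrite -expnMn.
  pose d := h - (h./2 - s.+1).*2.+1.
  have dE : h - d = (h./2 - s.+1).*2.+1 by have := odd_double_half h; lia.
  have dJ : d <= J'.*2 by have := odd_double_half h; lia.
  have d2 : d ^ 2 <= J'.*2 ^ 2 by rewrite leq_exp2r.
  have h_gt0 : 0 < h by lia.
  rewrite -dE leq_expr // -(leq_pmul2l h_gt0) mulnCA.
  apply: leq_trans (leq_mul (leqnn 2) (bin_near_middle _)); last by lia.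
  by rewrite -/c mulnCA [h * c]mulnC leq_mul2l; apply/orP; right; lia.
apply: (@leq_trans (\sum_(s < J') 'C(h + h, (h./2 - s.+1).*2.+1) ^ m)).
  rewrite -(leq_pmul2l (_ : 0 < 2 ^ m)) ?expn_gt0 // mulnA [2 ^ m * J]mulnC -/J'.
  rewrite -[X in X * _ <= _]card_ord -sum_nat_const big_distrr /=.
  by apply: leq_sum => s _; apply: term.
rewrite (big_ord_widen_cond h./2 xpredT (fun s => 'C(h + h, (h./2 - s.+1).*2.+1) ^ m) hJ).
rewrite [X in _ <= X](reindex_inj rev_ord_inj) /=.
by rewrite [X in _ <= X](bigID (fun s : 'I_h./2 => s < J')) /= leq_addr.
Qed.

From mathcomp Require Import all_algebra reals sequences exp.
From mathcomp Require Import lra ring.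
Import Order.TTheory GRing.Theory Num.Theory.

(** * Logarithmic estimates *)

Section LogEstimates.
Variable R : realType.
Local Open Scope ring_scope.
Implicit Types (a b k n p : nat).

Local Notation lnn n := (ln (n%:R : R)).

Lemma lnnM a b : (0 < a)%N -> (0 < b)%N -> lnn (a * b) = lnn a + lnn b.
Proof. by move=> a0 b0; rewrite natrM lnM // posrE ltr0n. Qed.

Lemma lnnX a k : (0 < a)%N -> lnn (a ^ k) = k%:R * lnn a.
Proof. by move=> a0; rewrite natrX lnXn ?ltr0n // mulr_natl. Qed.

Lemma lnn_ge0 n : 0 <= lnn n.
Proof. by case: n => [|n]; [rewrite ln0 | rewrite ln_ge0 // ler1n]. Qed.

Lemma ler_lnn a b : (0 < a)%N -> (a <= b)%N -> lnn a <= lnn b.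
Proof.
by move=> a0 ab; rewrite ler_ln ?ler_nat // posrE ltr0n // (leq_trans a0).
Qed.

Lemma leq_lnn a b : (0 < b)%N -> lnn a <= lnn b -> (a <= b)%N.
Proof.
move=> b0; have [->|a0] := posnP a; first by [].
by rewrite ler_ln ?ler_nat // posrE ltr0n.
Qed.

Lemma ln_le_subr1 (x : R) : 0 < x -> ln x <= x - 1.
Proof. by move=> x0; have := @le_ln1Dx R (x - 1); rewrite addrCA subrr addr0; apply; lra. Qed.

(** Both bounds are instances of ln x <= x - 1. *)
Lemma lnnS_bounds n : (0 < n)%N ->
  n%:R * (lnn n.+1 - lnn n) <= 1 /\ 1 <= n.+1%:R * (lnn n.+1 - lnn n).
Proof.
move=> n0; have x0 : 0 < n%:R :> R by rewrite ltr0n.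
have y0 : 0 < n.+1%:R :> R by rewrite ltr0n.
have yx : n.+1%:R = n%:R + 1 :> R by rewrite -natr1.
split.
  rewrite -ln_div ?posrE //; have := ler_wpM2l (ltW x0) (ln_le_subr1 (divr_gt0 y0 x0)).
  by move/le_trans; apply; rewrite yx mulrBr mulr1 mulrCA divff ?gt_eqF // mulr1; lra.
have := ler_wpM2l (ltW y0) (ln_le_subr1 (divr_gt0 x0 y0)); rewrite ln_div ?posrE //.
have -> : n.+1%:R * (n%:R / n.+1%:R - 1) = - 1 :> R.
  by rewrite mulrBr mulr1 mulrCA divff ?gt_eqF // mulr1 yx; lra.
lra.
Qed.

(** Both bounds share the terms n ln n - n. This accuracy matters: with k = p + 1
    blocks instead of p, the number of permutations preserving a partition only
    drops by a factor of about exp(n / p), so that no factor exponential in n can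
    be lost. *)
Lemma ln_fact_bounds n : (0 < n)%N ->
  n%:R * lnn n - n%:R <= lnn n`! <= (n%:R + 1) * lnn n - n%:R + 1.
Proof.
case: n => // n _; elim: n => [|n /andP[IHl IHu]]; first by rewrite ln1; lra.
have [lo up] := @lnnS_bounds n.+1 isT.
rewrite factS lnnM ?fact_gt0 //; move: lo up IHl IHu.
rewrite -(natr1 n.+1); set x := n.+1%:R; set l := ln _; set l' := ln _ => lo up IHl IHu.
by apply/andP; split; nra.
Qed.
Lemma log_large (x : R) : exists N, forall n, (N <= n)%N -> x <= lnn n.
Proof.
exists (Num.bound (expR x)) => n le_n.
have ex0 := expR_gt0 x.
rewrite -[x]expRK ler_ln ?posrE //.
  apply: ltW (lt_le_trans (archi_boundP (ltW ex0)) _).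
  by rewrite ler_nat.
rewrite ltr0n; apply: leq_trans le_n; rewrite -(ltr0n R).
exact: lt_trans (archi_boundP (ltW ex0)).
Qed.

(** Here ln k - ln p >= 1 / (2 p) is enough: writing n = y^12, the assumptions
    read p <= y^4 and k <= y^6, so the right-hand side is at least y^8 / 2, while
    the left-hand side is of order y^6 ln y. *)
Lemma log_gap_small_k C n p k : (0 < p)%N -> (p < k)%N -> (p ^ 3 <= n)%N ->
    (k ^ 2 <= n)%N -> ((24 * C.+1) ^ 12 <= n)%N ->
  (k%:R + C%:R) * lnn n <= n%:R * (lnn k - lnn p).
Proof.
move=> p0 pk p3 k2 Cn.
have n0 : (0 < n)%N by apply: leq_trans p3; rewrite expn_gt0 p0.
pose y := expR (lnn n / 12%:R).
have y0 : 0 < y by apply: expR_gt0.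
have yn : y ^+ 12 = n%:R by rewrite -expRM_natl mulrC divfK ?pnatr_eq0 // lnK // posrE ltr0n.
have py : p%:R <= y ^+ 4.
  by rewrite -(@ler_pXn2r R 3) ?nnegrE ?exprn_ge0 ?(ltW y0) ?ler0n // -exprM yn -natrX ler_nat.
have ky : k%:R <= y ^+ 6.
  by rewrite -(@ler_pXn2r R 2) ?nnegrE ?exprn_ge0 ?(ltW y0) ?ler0n // -exprM yn -natrX ler_nat.
have Cy : 24 * (C%:R + 1) <= y.
  rewrite -(@ler_pXn2r R 12) ?nnegrE ?(ltW y0) //; last by rewrite mulr_ge0 // addr_ge0.
  by rewrite yn natr1 -natrM -natrX ler_nat.
have y1 : 1 <= y by apply: le_trans Cy; have : 0 <= C%:R :> R by []; lra.
have lny : lnn n <= 12 * y.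
  have := ln_sublinear y0; rewrite expRK; lra.
set a := lnn k - lnn p.
have [_ up] := lnnS_bounds p0; have kS : lnn p.+1 <= lnn k by apply: ler_lnn.
have p1 : 1 <= p%:R :> R by rewrite ler1n.
have pS : p.+1%:R = p%:R + 1 :> R by rewrite natr1.
have a1 : 1 <= 2 * p%:R * a.
  have a0 : lnn p.+1 - lnn p <= a by rewrite lerB.
  have b0 : 0 <= lnn p.+1 - lnn p by rewrite subr_ge0 ler_lnn.
  rewrite pS in up a0 b0; apply: le_trans up _; apply: ler_pM => //; lra.
have a0 : 0 <= a by rewrite -(pmulr_rge0 _ (_ : 0 < 2 * p%:R)); [exact: le_trans a1 | lra].
have C0 : 0 <= C%:R :> R by [].
have step1 : y ^+ 8 / 2 <= n%:R * a.
  have : y ^+ 8 * p%:R * a <= n%:R * a.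
    by rewrite -yn ler_wpM2r // (_ : 12 = 8 + 4)%N // exprD ler_wpM2l // exprn_ge0 // ltW.
  have : y ^+ 8 * 1 <= y ^+ 8 * (2 * p%:R * a) by rewrite ler_wpM2l // exprn_ge0 // ltW.
  move: (y ^+ 8) => z; nra.
apply: le_trans step1.
apply: (@le_trans _ _ ((y ^+ 6 + C%:R) * (12 * y))).
  by apply: ler_pM => //; rewrite ?addr_ge0 ?lnn_ge0 // lerD2r.
have y7 : y <= y ^+ 7 by rewrite -{1}[y]expr1 ler_weXn2l.
have Ey : y ^+ 7 = y ^+ 6 * y by rewrite exprSr.
have E8 : y ^+ 8 = y ^+ 7 * y by rewrite exprSr.
have : y ^+ 7 * (24 * (C%:R + 1)) <= y ^+ 7 * y by rewrite ler_wpM2l // exprn_ge0 // ltW.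
have : C%:R * y <= C%:R * y ^+ 7 by rewrite ler_wpM2l.
rewrite E8 Ey; set z := y ^+ 6; nra.
Qed.

(** Here ln k >= (ln n) / 2, while ln p <= (ln n) / 3. This settles the case
    k <= n / 7. Otherwise p <= 6 because p k <= n, so ln k - ln p is within a
    constant of ln n, and k <= n / 2. *)
Lemma log_gap_large_k C n p k : (0 < p)%N -> (p ^ 3 <= n)%N -> (1 < p)%N ->
    (p * k <= n)%N -> (n < k ^ 2)%N -> (42 * C <= n)%N -> 3 * lnn 42 <= lnn n ->
  (k%:R + C%:R) * lnn n <= n%:R * (lnn k - lnn p).
Proof.
move=> p0 p3 p1 pk k2 Cn ln42.
have n0 : (0 < n)%N by apply: leq_trans p3; rewrite expn_gt0 p0.
have k0 : (0 < k)%N by case: (k) k2.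
have l0 := lnn_ge0 n.
have Cn' : 42 * C%:R <= n%:R :> R by rewrite -natrM ler_nat.
have nR : 0 <= n%:R :> R by [].
have gap (c : R) : k%:R + C%:R <= n%:R * c -> c * lnn n <= lnn k - lnn p ->
    (k%:R + C%:R) * lnn n <= n%:R * (lnn k - lnn p).
  move=> kC cl; apply: (@le_trans _ _ (n%:R * c * lnn n)); first by rewrite ler_wpM2r.
  by rewrite -mulrA ler_wpM2l.
have [k7|k7] := leqP (7 * k) n.
  apply: (gap (1 / 6)) => //.
    have : 7 * k%:R <= n%:R :> R by rewrite -natrM ler_nat.
    lra.
  have : lnn (p ^ 3) <= lnn n by rewrite ler_lnn // expn_gt0 p0.
  have : lnn n <= lnn (k ^ 2) by rewrite ler_lnn // ltnW.
  rewrite !lnnX //; lra.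
have p6 : (p <= 6)%N by nia.
apply: (gap (2 / 3)) => //.
  have : 2 * k%:R <= n%:R :> R by rewrite -natrM ler_nat; nia.
  lra.
have : lnn n <= lnn (7 * k) by rewrite ler_lnn // ltnW.
have : lnn p <= lnn 6 by rewrite ler_lnn.
have : lnn 42 = lnn 7 + lnn 6 by rewrite -lnnM.
rewrite lnnM //; lra.
Qed.

(** This inequality controls the groups that preserve k > p blocks: its
    exponential compares (k / p)^n with n^(k + C). *)
Lemma log_gap C : exists N0, forall n p k : nat, (N0 <= n)%N -> (1 < p)%N -> (p < k)%N ->
    (p ^ 3 <= n)%N -> (p * k <= n)%N ->
  (k%:R + C%:R) * lnn n <= n%:R * (lnn k - lnn p).
Proof.
have [N1 N1P] := log_large (3 * lnn 42).
exists (maxn N1 ((24 * C.+1) ^ 12)) => n p k; rewrite geq_max => /andP[n1 n2] p1 pk p3 pkn.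
have p0 : (0 < p)%N by apply: ltnW.
have [k2|k2] := leqP (k ^ 2) n; first exact: log_gap_small_k.
apply: log_gap_large_k => //; last exact: N1P.
apply: leq_trans n2; apply: (@leq_trans ((24 * C.+1) ^ 2)%N).
  by rewrite expnS expn1; nia.
by rewrite leq_pexp2l.
Qed.
(** By Stirling's bounds with b = n / k, the quotient of n! by (b!)^k k! is
    k^n up to a factor n^(k + O(1)), and log_gap makes it larger than n^C p^n. *)
Lemma imprimitive_estimate C : exists N0, forall n p k b : nat, (N0 <= n)%N ->
    (1 < p)%N -> (p < k)%N -> (p ^ 3 <= n)%N -> (p <= b)%N -> (k * b)%N = n ->
  (n ^ C * (b`! ^ k * k`! * p ^ n) <= n`!)%N.
Proof.
have [N1 N1P] := log_large 1; have [N2 N2P] := log_gap C.+2.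
exists (maxn N1 N2) => n p k b; rewrite geq_max => /andP[/N1P ln1 n2] p1 pk p3 pb kbn.
have p0 : (0 < p)%N by apply: ltnW.
have b0 : (0 < b)%N by apply: leq_trans pb.
have k0 : (0 < k)%N by apply: leq_ltn_trans pk.
have n0 : (0 < n)%N by rewrite -kbn muln_gt0 k0.
have pkn : (p * k <= n)%N by rewrite -kbn mulnC leq_mul2l pb orbT.
have gap := N2P n p k n2 p1 pk p3 pkn.
apply: leq_lnn; first exact: fact_gt0.
rewrite lnnM ?muln_gt0 ?expn_gt0 ?fact_gt0 ?n0 ?p0 // lnnM ?muln_gt0 ?expn_gt0 ?fact_gt0 ?p0 //.
rewrite lnnM ?expn_gt0 ?fact_gt0 // !lnnX ?fact_gt0 //.
have /andP[lo _] := ln_fact_bounds n0.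
have /andP[_ upk] := ln_fact_bounds k0.
have /andP[_ upb] := ln_fact_bounds b0.
have lnE : lnn n = lnn k + lnn b by rewrite -kbn lnnM.
have nE : n%:R = k%:R * b%:R :> R by rewrite -kbn natrM.
have lkn : lnn k <= lnn n by rewrite lnE lerDl lnn_ge0.
have kR : 0 <= k%:R :> R by [].
have C2 : C.+2%:R = C%:R + 2 :> R by rewrite -addn2 natrD.
have upb' := ler_wpM2l kR upb.
rewrite C2 in gap; apply: le_trans lo.
have e1 : k%:R * ((b%:R + 1) * lnn b - b%:R + 1) =
          n%:R * lnn b + k%:R * lnn b - n%:R + k%:R by rewrite nE; ring.
have lbE : lnn b = lnn n - lnn k by rewrite lnE; ring.
rewrite e1 lbE in upb'; lra.
Qed.

Lemma ln_cube n p : (0 < p)%N -> (p ^ 3 <= n)%N -> 3 * lnn p <= lnn n.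
Proof.
move=> p0 p3; have : lnn (p ^ 3) <= lnn n by rewrite ler_lnn // expn_gt0 p0.
by rewrite lnnX.
Qed.

(** As p^3 <= n, the logarithm of p^n is at most (n ln n) / 3, while that of the
    factorial is about (n ln n) / 2. *)
Lemma primitive_estimate : exists N0, forall n p : nat, (N0 <= n)%N ->
    (0 < p)%N -> (p ^ 3 <= n)%N ->
  (2 * (p ^ n * n ^ 3) <= (uphalf n)`!)%N.
Proof.
have [N1 N1P] := log_large 24.
exists (maxn N1 96) => n p; rewrite geq_max => /andP[/N1P ln1 n2] p0 p3.
have n0 : (0 < n)%N by apply: leq_trans n2.
set q := uphalf n; have q2 : (n <= 2 * q)%N by rewrite /q uphalf_half; lia.
have q0 : (0 < q)%N by lia.
apply: leq_lnn; first exact: fact_gt0.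
rewrite !lnnM ?muln_gt0 ?expn_gt0 ?n0 ?p0 // !lnnX //.
have /andP[lo _] := ln_fact_bounds q0.
have lp := ln_cube p0 p3.
have lq : lnn n <= lnn 2 + lnn q by rewrite -lnnM // ler_lnn.
have l2 : lnn 2 < 2 by apply: ln_sublinear; rewrite ltr0n.
have qR : n%:R <= 2 * q%:R :> R by rewrite -natrM ler_nat.
have nR : 96 <= n%:R :> R by rewrite ler_nat.
apply: le_trans lo.
have h1 : n%:R * lnn p <= n%:R * (lnn n / 3) by rewrite ler_wpM2l //; lra.
have h2 : n%:R / 2 * (lnn n - 3) <= q%:R * (lnn q - 1) by apply: ler_pM; lra.
have h3 : 96 * lnn n <= n%:R * lnn n by rewrite ler_wpM2r //; lra.
have h4 : n%:R * 24 <= n%:R * lnn n by rewrite ler_wpM2l.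
lra.
Qed.

(** As p^3 <= n, the logarithm of p^(2 n) is at most (2 n ln n) / 3, while that of
    the factorial is about n ln n. *)
Lemma diagonal_estimate : exists N0, forall n p : nat, (N0 <= n)%N ->
    (0 < p)%N -> (p ^ 3 <= n)%N ->
  (2 * ((p ^ n) ^ 2 * (n ^ 3) ^ 2) <= n`!)%N.
Proof.
have [N1 N1P] := log_large 24.
exists (maxn N1 96) => n p; rewrite geq_max => /andP[/N1P ln1 n2] p0 p3.
have n0 : (0 < n)%N by apply: leq_trans n2.
apply: leq_lnn; first exact: fact_gt0.
rewrite -!expnM !lnnM ?muln_gt0 ?expn_gt0 ?n0 ?p0 // !lnnX //.
have /andP[lo _] := ln_fact_bounds n0.
have lp := ln_cube p0 p3.
have l2 : lnn 2 < 2 by apply: ln_sublinear; rewrite ltr0n.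
have nR : 96 <= n%:R :> R by rewrite ler_nat.
apply: le_trans lo.
have h1 : n%:R * lnn p <= n%:R * (lnn n / 3) by rewrite ler_wpM2l //; lra.
have h3 : 96 * lnn n <= n%:R * lnn n by rewrite ler_wpM2r //; lra.
have h4 : n%:R * 24 <= n%:R * lnn n by rewrite ler_wpM2l.
rewrite natrM; lra.
Qed.

End LogEstimates.

(** * Passage to the limit *)

Section Eventually.
Variables (R : realType) (m J : nat).
Hypothesis m_gt0 : 0 < m.

(** With L the sum of the N i ^ m from the lower bound, everything in u but L is
    negligible. For n odd, L = N ^ m where N >= n^3 2^n by imprimitive_estimate
    with p blocks in place of k, and 2 in place of p, whereas the subset
    stabilizers contribute at most n (2^n)^m. For n even, the partitions into
    halves contribute at most the m-th power of the central binomial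
    coefficient, and L contains many terms of nearly this size. *)
Lemma eventually_sandwich : exists N0, forall n, N0 <= n -> pdiv n ^ 3 <= n ->
  exists L, [/\ 0 < L, L <= sigma [set: alt_wreath n m]%G,
    sigma [set: alt_wreath n m]%G <= u m n & J * u m n <= J.+1 * L].
Proof.
have [N1 H1] := imprimitive_estimate R 4.
have [N2 H2] := primitive_estimate R.
have [N3 H3] := diagonal_estimate R.
have [h0 H4] := odd_bin_sum_large m (2 * J).+1.
(* For n odd, J (alpha m + n) <= n^3 is also needed: hence m and J. *)
exists (N1 + N2 + N3 + h0.*2 + m + J + 8) => n le_n p3; set p := pdiv n in p3.
have n1 : 1 < n by lia.
have n0 : 0 < n by lia.
have n2 : 2 <= n by lia.
have n4 : 4 < n by lia.
have pr_p : prime p by apply: pdiv_prime.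
have p1 := prime_gt1 pr_p; have p0 := ltnW p1.
have bochert : 2 * (p ^ n * n ^ 3) <= (uphalf n)`! by apply: H2 => //; lia.
have diag : 2 * ((p ^ n) ^ 2 * (n ^ 3) ^ 2) <= n`! by apply: H3 => //; lia.
have imprim k b : p < k -> 1 < b -> k * b = n -> 2 * (b`! ^ k * k`! * (p ^ n * n ^ 3)) <= n`!.
  move=> pk b1 kbn; have pb : p <= b by apply: pdiv_min_dvd => //; rewrite -kbn dvdn_mull.
  apply: leq_trans (H1 n p k b _ p1 pk p3 pb kbn); last by lia.
  by move: (b`! ^ k * k`!) (p ^ n) => x y; rewrite (expnS n 3); nia.
have am := alpha_le m_gt0.
have [on|en] := boolP (odd n).
  have pbn : p * (n %/ p) = n by rewrite mulnC divnK // pdiv_dvd.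
  set b := n %/ p in pbn.
  have pb : p <= b by move: p3; rewrite -pbn !expnS expn0 muln1 leq_pmul2l //; apply/leq_trans/leq_pmulr.
  have b1 : 1 < b by apply: leq_trans pb.
  have := odd_degree_bounds m_gt0 n4 bochert imprim diag on (erefl _) pbn b1.
  set N := #|_| => -[lowN sigu leu leN].
  have p2 : 2 < p.
    by rewrite ltn_neqAle p1 andbT; apply: contraTneq on => e; rewrite -dvdn2 e pdiv_dvd.
  have big : n ^ 4 * (b`! ^ p * p`! * 2 ^ n) <= n`! by apply: H1 => //; lia.
  have NN : n ^ 3 * 2 ^ n <= N.
    have f_gt0 : 0 < b`! ^ p * p`! by rewrite muln_gt0 expn_gt0 !fact_gt0.
    have := leq_trans big leN; move: (b`! ^ p * p`!) f_gt0 (2 ^ n) => x x0 y.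
    rewrite (expnS n 3) => le; rewrite -(leq_pmul2l x0) -(leq_pmul2l (isT : 0 < 2)).
    by apply: leq_trans le; rewrite -[X in _ <= X]mulnA (mulnCA (n ^ 3) x) leq_mul2r n2 orbT.
  have y_gt0 : 0 < (2 ^ n) ^ m by rewrite !expn_gt0.
  have NNm : n ^ 3 * (2 ^ n) ^ m <= N ^ m.
    apply: leq_trans (leq_expr m NN); rewrite expnMn leq_mul2r; apply/orP; right.
    by rewrite -{1}[n ^ 3]expn1 leq_pexp2l // expn_gt0 n0.
  have Npos : 0 < N ^ m by apply: leq_trans NNm; rewrite muln_gt0 y_gt0 expn_gt0 n0.
  exists (N ^ m); split=> //.
  have sum_le : \sum_(i < n.-1) 'C(n, i.+1) ^ m <= n * (2 ^ n) ^ m.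
    apply: (@leq_trans (\sum_(i < n.-1) (2 ^ n) ^ m)).
      by apply: leq_sum => i _; rewrite leq_expr // bin_le_exp2.
    by rewrite sum_nat_const card_ord leq_mul2r leq_pred orbT.
  rewrite mulSn addnC; apply: leq_trans (leq_mul (leqnn J) leu) _.
  have am3 : J * (alpha m + n) <= n ^ 3.
    apply: (@leq_trans (n * (n + n))); first by rewrite leq_mul //; lia.
    by rewrite !expnS expn0 muln1 leq_mul2l addnn -mul2n leq_mul2r n2 !orbT.
  apply: (@leq_trans (J * (alpha m + n) * (2 ^ n) ^ m + J * N ^ m)).
    rewrite addnA mulnDr leq_add2r -mulnA leq_mul2l; apply/orP; right.
    by rewrite mulnDl leq_add // leq_pmulr.
  by rewrite addnC leq_add2l; apply: leq_trans NNm; rewrite leq_mul2r am3 orbT.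
pose h := n./2; have hn : h + h = n by rewrite addnn /h -[RHS]odd_double_half (negbTE en).
have p2 : p = 2.
  by apply/eqP; rewrite eqn_leq p1 andbT pdiv_min_dvd // dvdn2 en.
have [] := even_degree_bounds m_gt0 n4 bochert imprim diag hn p2.
set L := \sum_(j < _) _ => lowL sigu leu.
have h0h : h0 <= h by rewrite -leq_double -addnn -[X in _ <= X]addnn hn addnn; lia.
have := H4 h h0h; rewrite hn -/L; set c := 'C(n, h) ^ m => HL.
have c2 : 2 ^ m <= c.
  rewrite leq_expr // -hn; have : 0 < h by lia.
  case: (h) => // k _; rewrite addnS binS.
  have : 0 < 'C(k.+1 + k, k.+1) by rewrite bin_gt0 leq_addr.
  have : 0 < 'C(k.+1 + k, k) by rewrite bin_gt0 leq_addl.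
  lia.
have ac : alpha m <= c.
  by apply: leq_trans am (leq_trans _ c2); apply/ltnW/ltn_expl.
have c_gt0 : 0 < c by apply: leq_trans c2; rewrite expn_gt0.
exists L; split=> //; first by apply: leq_trans HL; rewrite muln_gt0.
rewrite mulSn addnC; apply: leq_trans (leq_mul (leqnn J) leu) _.
rewrite addnCA mulnDr leq_add2l; apply: leq_trans HL.
apply: (@leq_trans (J * (c + c))); first by rewrite leq_mul2l leq_add2r ac orbT.
by rewrite addnn -mul2n mulnA [J * 2]mulnC leq_mul2r leqnSn orbT.
Qed.
End Eventually.

From mathcomp Require Import all_classical all_reals all_analysis.
Import numFieldNormedType.Exports.

Local Open Scope classical_set_scope.
Local Open Scope ring_scope.

Lemma root_bound_pdiv (R : realType) n p : prime p -> (p %| n)%N ->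
  (p%:R : R) <= n%:R `^ 3^-1 -> (pdiv n ^ 3 <= n)%N.
Proof.
move=> pr_p pn pR; have le_p : (pdiv n <= p)%N by rewrite pdiv_min_dvd ?prime_gt1.
apply: (@leq_trans (p ^ 3)%N); first by rewrite leq_exp2r.
rewrite -(ler_nat R) natrX.
have -> : n%:R = (n%:R `^ 3^-1 : R) ^+ 3.
  by rewrite -powR_mulrn ?powR_ge0 // -powRrM mulVf ?pnatr_eq0 // powRr1.
by rewrite lerXn2r ?nnegrE ?powR_ge0.
Qed.

Theorem theorem1p5 (R : realType) (m : nat) (hm : (0 < m)%N) :
  (sigma [set: alt_wreath n m]%G)%:R / (u m n)%:R
    @[n --> within
        [set n : nat | exists2 p : nat,
           prime p /\ (p %| n)%N & (p%:R : R) <= n%:R `^ 3^-1] \oo]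
    --> (1 : R).
Proof.
apply/cvgrPdist_lt => /= e e0.
pose J := Num.bound e^-1.
have eJ : J%:R^-1 < e.
  have eV0 : 0 < e^-1 by rewrite invr_gt0.
  have lt := archi_boundP (ltW eV0).
  by rewrite -[e]invrK ltf_pV2 ?posrE // (lt_trans eV0).
have [N0 sandwich] := @eventually_sandwich R m J hm.
rewrite near_withinE; exists N0 => // n /= N0n [p [pr_p pn] pR].
have [L [L0 Lsig sigu Ju]] := sandwich n N0n (root_bound_pdiv pr_p pn pR).
set s := sigma _ in Lsig sigu *; set v := u m n in sigu Ju *.
have s0 : (0 < s)%N by apply: leq_trans Lsig.
have v0 : (0 < v)%N by apply: leq_trans sigu.
have vR : 0 < v%:R :> R by rewrite ltr0n.
have sv : s%:R / v%:R <= 1 :> R by rewrite ler_pdivrMr // mul1r ler_nat.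
rewrite ger0_norm ?subr_ge0 //; apply: le_lt_trans eJ.
have J0 : 0 < J%:R :> R.
  by apply: le_lt_trans (archi_boundP _); rewrite ?invr_ge0 ltW.
have -> : 1 - s%:R / v%:R = (v%:R - s%:R) / v%:R :> R.
  by rewrite mulrBl divff ?gt_eqF.
rewrite ler_pdivrMr // ler_pdivlMl // mulrBr -!natrM.
have Js : (J * v <= J.+1 * s)%N by apply: leq_trans Ju _; rewrite leq_mul2l Lsig orbT.
by rewrite lerBlDr -natrD ler_nat (leq_trans Js) // mulSn leq_add2r.
Qed.
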